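(* Let $E:=\mathbb{R}^{\mathbb{N}}$ with the product topology, and let $E\otimes E$, $(E\otimes E)\otimes E$ and $E\otimes(E\otimes E)$ be the (iterated) tensor products formed in the class of all real topological vector spaces. Let $\mathcal{A}$ be any one of the following classes: (i) the class of Hausdorff real topological vector spaces; (ii) the class of complete Hausdorff real topological vector spaces; (iii) the class of Hausdorff abelian topological groups. Then $E\otimes E$, $(E\otimes E)\otimes E$ and $E\otimes(E\otimes E)$ (in case (iii) considered as abelian topological groups) are also the respective tensor products in the class $\mathcal{A}$, and the associative law for tensor products fails in $\mathcal{A}$: there is no continuous linear map (in case (iii): no continuous group homomorphism) $\Theta:(E\otimes E)\otimes E\to E\otimes(E\otimes E)$ such that $\Theta((x\otimes y)\otimes z)=x\otimes(y\otimes z)$ for all $x,y,z\in E$. In particular, the canonical map $(x\otimes y)\otimes z\mapsto x\otimes(y\otimes z)$ does not define an isomorphism in the corresponding category.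
   Context: $\mathbb{N}=\{1,2,\ldots\}$. Topological vector spaces are not presumed Hausdorff (unless stated) or locally convex. Let $\mathcal{A}$ be a class of real topological vector spaces (resp., of abelian topological groups) closed under finite cartesian products. Given $E_1,\ldots,E_n\in\mathcal{A}$ ($n\ge2$), a tensor product of $E_1,\ldots,E_n$ in the class $\mathcal{A}$ is an element $T\in\mathcal{A}$ together with an $n$-linear (resp., $n$-additive, i.e. additive in each variable) continuous map $\tau:E_1\times\cdots\times E_n\to T$ such that for every $F\in\mathcal{A}$ and every $n$-linear (resp., $n$-additive) continuous map $f:E_1\times\cdots\times E_n\to F$ there exists a unique continuous linear map (resp., continuous homomorphism) $\widetilde f:T\to F$ with $\widetilde f\circ\tau=f$. For the class of all real topological vector spaces, the tensor product $E_1\otimes\cdots\otimes E_n$ is realized as follows: the underlying vector space is the algebraic tensor product $T=E_1\otimes_{\mathbb{R}}\cdots\otimes_{\mathbb{R}}E_n$ with $\tau(x_1,\ldots,x_n)=x_1\otimes\cdots\otimes x_n$, and a basis of zero-neighbourhoods for its vector topology is given by the sets $$\bigcup_{k\in\mathbb{N}}\sum_{\ell=1}^{k}\tau(U_{\ell,1}\times\cdots\times U_{\ell,n}),$$ where, for each $j=1,\ldots,n$, $(U_{k,j})_{k\in\mathbb{N}}$ is a sequence of balanced zero-neighbourhoods in $E_j$. In $(E\otimes E)\otimes E$ and $E\otimes(E\otimes E)$, the inner $E\otimes E$ carries its tensor product topology. *)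

(* Defs.v *)
From HB Require Import structures.
From mathcomp Require Import all_boot all_order all_algebra.
From mathcomp Require Import sesquilinear generic_quotient ring_quotient freeg.
From mathcomp Require Import boolp classical_sets functions reals topology.
From mathcomp Require Import tvs.

Set Implicit Arguments.
Unset Strict Implicit.
Unset Printing Implicit Defensive.

Import Order.TTheory GRing.Theory Num.Theory.
Import numFieldTopology.Exports.
Local Open Scope classical_set_scope.
Local Open Scope ring_scope.

Section AlgebraicTensor.
Context (K : fieldType) (E F : lmodType K).

(* [tensor_null] is the submodule spanned by the bilinearity relations in the
   free module on [E * F]; [alg_tensor] is the quotient by it. *)
Inductive tensor_null : {freeg (E * F)%type / K} -> Prop :=
| tensor_null0 : tensor_null 0
| tensor_nullDZ a u v :
    tensor_null u -> tensor_null v -> tensor_null (a *: u + v)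
| tensor_null_linl a x x' y :
    tensor_null (<<(a *: x + x', y)>> - (a *: <<(x, y)>> + <<(x', y)>>))
| tensor_null_linr a x y y' :
    tensor_null (<<(x, a *: y + y')>> - (a *: <<(x, y)>> + <<(x, y')>>)).

Definition tensor_ker : {pred {freeg (E * F)%type / K}} :=
  fun u => `[< tensor_null u >].

Lemma tensor_kerP u : reflect (tensor_null u) (u \in tensor_ker).
Proof. exact: asboolP. Qed.

Lemma tensor_ker_zmod_closed : zmod_closed tensor_ker.
Proof.
split=> [|u v /tensor_kerP nu /tensor_kerP nv]; apply/tensor_kerP.
  exact: tensor_null0.
by rewrite addrC -scaleN1r; exact: tensor_nullDZ.
Qed.

HB.instance Definition _ :=
  GRing.isZmodClosed.Build _ tensor_ker tensor_ker_zmod_closed.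

Definition alg_tensor : Type := Quotient.quot tensor_ker.

HB.instance Definition _ := GRing.Zmodule.on alg_tensor.

Definition alg_tensor_proj (u : {freeg (E * F)%type / K}) : alg_tensor :=
  (\pi_(Quotient.quot tensor_ker) u)%qT.

Lemma alg_tensor_projP u v :
  reflect (alg_tensor_proj u = alg_tensor_proj v) (u - v \in tensor_ker).
Proof. by rewrite Quotient.idealrBE; apply: eqP. Qed.

Lemma alg_tensor_projD : {morph alg_tensor_proj : u v / u + v}.
Proof. by move=> u v; rewrite /alg_tensor_proj piE. Qed.

Lemma alg_tensor_projB : {morph alg_tensor_proj : u v / u - v}.
Proof. by move=> u v; rewrite /alg_tensor_proj !piE. Qed.

Lemma alg_tensor_proj_ex (t : alg_tensor) : exists u, t = alg_tensor_proj u.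
Proof. by exists (repr t); rewrite /alg_tensor_proj reprK. Qed.

Definition alg_tensor_scale (a : K) (t : alg_tensor) : alg_tensor :=
  alg_tensor_proj (a *: repr (t : Quotient.quot tensor_ker)).

Lemma alg_tensor_projZ a u :
  alg_tensor_scale a (alg_tensor_proj u) = alg_tensor_proj (a *: u).
Proof.
apply/alg_tensor_projP; rewrite -scalerBr; apply/tensor_kerP.
rewrite -[_ *: _]addr0; apply: tensor_nullDZ tensor_null0.
by apply/tensor_kerP/alg_tensor_projP; rewrite /alg_tensor_proj reprK.
Qed.

Lemma alg_tensor_scaleA a b t :
  alg_tensor_scale a (alg_tensor_scale b t) = alg_tensor_scale (a * b) t.
Proof.
by have [u ->] := alg_tensor_proj_ex t; rewrite !alg_tensor_projZ scalerA.
Qed.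

Lemma alg_tensor_scale1 : left_id 1 alg_tensor_scale.
Proof.
move=> t; have [u ->] := alg_tensor_proj_ex t.
by rewrite alg_tensor_projZ scale1r.
Qed.

Lemma alg_tensor_scaleDr : right_distributive alg_tensor_scale +%R.
Proof.
move=> a t t'; have [u ->] := alg_tensor_proj_ex t.
have [v ->] := alg_tensor_proj_ex t'.
by rewrite -alg_tensor_projD !alg_tensor_projZ scalerDr alg_tensor_projD.
Qed.

Lemma alg_tensor_scaleDl t : {morph alg_tensor_scale^~ t : a b / a + b}.
Proof.
move=> a b; have [u ->] := alg_tensor_proj_ex t.
by rewrite !alg_tensor_projZ scalerDl alg_tensor_projD.
Qed.

HB.instance Definition _ := GRing.Zmodule_isLmodule.Build K alg_tensor
  alg_tensor_scaleA alg_tensor_scale1 alg_tensor_scaleDr alg_tensor_scaleDl.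

Definition alg_tens (x : E) (y : F) : alg_tensor := alg_tensor_proj <<(x, y)>>.

Lemma alg_tensor_proj_linear : linear alg_tensor_proj.
Proof.
by move=> a u v; rewrite alg_tensor_projD; congr (_ + _); rewrite -alg_tensor_projZ.
Qed.

Lemma alg_tens_bilinear : bilinear_for *:%R *:%R alg_tens.
Proof.
split=> [y a x x'|x a y y'] /=; rewrite -alg_tensor_proj_linear;
  apply/alg_tensor_projP/tensor_kerP.
  exact: tensor_null_linl.
exact: tensor_null_linr.
Qed.

HB.instance Definition _ := bilinear_isBilinear.Build K E F alg_tensor
  *:%R *:%R alg_tens alg_tens_bilinear.

Lemma alg_tensor_sum (t : alg_tensor) :
  exists k (x : nat -> E) (y : nat -> F), t = \sum_(l < k) alg_tens (x l) (y l).
Proof.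
have [u ->] := alg_tensor_proj_ex t.
pose s := dom u; pose p i := nth (0, 0) s i.
exists (size s), (fun i => coeff (p i) u *: (p i).1), (fun i => (p i).2).
rewrite -[in LHS](freeg_sumE u) (big_nth (0, 0)) big_mkord.
pose L := GRing.isLinear.Build _ _ _ _ alg_tensor_proj alg_tensor_proj_linear.
pose f : {linear _ -> _} := HB.pack alg_tensor_proj L.
rewrite -[LHS]/(f _) linear_sum; apply: eq_bigr => i _; rewrite linearZl_LR.
rewrite /alg_tens -[RHS]/(_ *: f _) -linearZ; congr (f _).
rewrite -/(p i); apply/eqP/freeg_eqP => z.
by rewrite coeffZ !coeffU mul1r -surjective_pairing.
Qed.

Section Lift.
Context (G : lmodType K) (f : E -> F -> G).

Definition tensor_lift (t : alg_tensor) : G :=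
  fglift (fun p => f p.1 p.2) (repr (t : Quotient.quot tensor_ker)).

Lemma fglift_linear (g : E * F -> G) : linear (fglift g).
Proof.
pose A := GRing.isZmodMorphism.Build _ _ _ (lift_is_additive g).
pose h : {additive _ -> _} := HB.pack (fglift g) A.
move=> a u v; rewrite -[LHS]/(h _) raddfD; congr (_ + _) => /=.
have hE w : h w = \sum_(p <- dom w) coeff p w *: g p.
  rewrite -[in LHS](freeg_sumE w) raddf_sum.
  by apply: eq_bigr => p _; rewrite /= liftU.
rewrite -[RHS]/(_ *: h u) hE -[in LHS](freeg_sumE u) !scaler_sumr.
rewrite -[LHS]/(h _) raddf_sum.
apply: eq_bigr => p _ /=; rewrite scalerA -(liftU g) -[LHS]/(fglift g _); congr fglift.
by apply/eqP/freeg_eqP => z; rewrite coeffZ !coeffU mulrA.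
Qed.

Hypothesis bf : bilinear_for *:%R *:%R f.

Lemma tensor_lift_proj u :
  tensor_lift (alg_tensor_proj u) = fglift (fun p => f p.1 p.2) u.
Proof.
set g := fun p => _; have gL := fglift_linear g.
pose h : {linear _ -> _} :=
  HB.pack (fglift g) (GRing.isLinear.Build _ _ _ _ _ gL).
have ker w : tensor_null w -> h w = 0.
  elim=> [|a w1 w2 _ h1 _ h2|a x x' y|a x y y'].
  - exact: linear0.
  - by rewrite linearP h1 h2 scaler0 addr0.
  - by rewrite linearB linearP /= !liftU !scale1r /g /= bf.1 subrr.
  - by rewrite linearB linearP /= !liftU !scale1r /g /= bf.2 subrr.
apply/eqP; rewrite -subr_eq0 -[_ - _]/(h _ - h _) -linearB ker//.
by apply/tensor_kerP/alg_tensor_projP; rewrite /alg_tensor_proj reprK.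
Qed.

Lemma tensor_lift_linear : linear tensor_lift.
Proof.
move=> a t t'; have [u ->] := alg_tensor_proj_ex t.
have [v ->] := alg_tensor_proj_ex t'.
by rewrite -alg_tensor_proj_linear !tensor_lift_proj fglift_linear.
Qed.

Lemma tensor_liftE x y : tensor_lift (alg_tens x y) = f x y.
Proof. by rewrite tensor_lift_proj liftU scale1r. Qed.

End Lift.
End AlgebraicTensor.

Definition balanced (K : numDomainType) (E : lmodType K) (U : set E) :=
  forall a x, `|a| <= 1 -> U x -> U (a *: x).

Section TopologicalLmodTheory.
Context (R : realType) (G : topologicalLmodType R).
Implicit Types (U V : set G) (x y : G) (a b : R).

Lemma nbhs_translate x U : nbhs x U <-> nbhs (0 : G) [set y | U (x + y)].
Proof.
split=> nU.
  have := @add_continuous G (x, 0) U; rewrite /= addr0 => /(_ nU).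
  by move=> [[A B] [/= xA B0] AB]; apply: filterS B0 => y By;
    apply: (AB (x, y)); split=> //; exact: nbhs_singleton.
have := @add_continuous G (- x, x) [set y | U (x + y)].
rewrite /= addNr => /(_ nU) [[A B] [/= xA B0] AB]; apply: filterS B0 => y By.
have /(_ (- x, y)) := AB; rewrite /= addrA subrr add0r; apply.
by split=> //; exact: nbhs_singleton.
Qed.

Lemma nbhs0_split U : nbhs (0 : G) U ->
  exists2 V, nbhs (0 : G) V & forall x y, V x -> V y -> U (x + y).
Proof.
move=> nU; have := @add_continuous G (0, 0) U; rewrite /= addr0 => /(_ nU).
move=> [[A B] [/= A0 B0] AB]; exists (A `&` B); first exact: filterI.
by move=> x y [Ax _] [_ By]; exact: (AB (x, y)).
Qed.

Lemma nbhs0_scale a U : nbhs (0 : G) U -> nbhs (0 : G) [set x | U (a *: x)].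
Proof.
move=> nU; have := @scale_continuous R G (a, 0) U; rewrite /= scaler0.
move=> /(_ nU) [[A B] [/= A0 B0] AB]; apply: filterS B0 => x Bx.
by apply: (AB (a, x)); split=> //; exact: nbhs_singleton.
Qed.

Lemma nbhs0_balanced U : nbhs (0 : G) U ->
  exists2 V, nbhs (0 : G) V /\ balanced V & V `<=` U.
Proof.
move=> nU; have := @scale_continuous R G (0, 0) U; rewrite /= scale0r.
move=> /(_ nU) [[A B] [/= /nbhs_ballP[e /= e0 eA] B0] AB].
exists [set x | exists a y, [/\ `|a| < e, B y & x = a *: y]]; last first.
  move=> _ [a [y [ae By ->]]]; apply: (AB (a, y)); split=> //=.
  by apply: eA; rewrite /ball /= sub0r normrN.
split=> [|a x a1 [b [y [be By ->]]]]; last first.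
  exists (a * b), y; split=> //; last by rewrite scalerA.
  by rewrite normrM (le_lt_trans _ be)// ler_piMl.
apply: filterS (nbhs0_scale (2^-1 * e)^-1 B0) => x Bx.
have e2 : 0 < 2^-1 * e by rewrite mulr_gt0// invr_gt0.
exists (2^-1 * e), ((2^-1 * e)^-1 *: x); split=> //.
  by rewrite gtr0_norm// gtr_pMl// invf_lt1// ltr1n.
by rewrite scalerA divff ?scale1r// gt_eqF.
Qed.

Lemma nbhs0_absorbing U x : nbhs (0 : G) U ->
  exists2 e : R, 0 < e & forall a, `|a| <= e -> U (a *: x).
Proof.
move=> nU; have := @scale_continuous R G (0, x) U; rewrite /= scale0r.
move=> /(_ nU) [[A B] [/= /nbhs_ballP[e /= e0 eA] B0] AB].
exists (2^-1 * e) => [|a ae]; first by rewrite mulr_gt0// invr_gt0.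
apply: (AB (a, x)); split=> /=; last exact: nbhs_singleton.
apply: eA; rewrite /ball /= sub0r normrN (le_lt_trans ae)//.
by rewrite gtr_pMl// invf_lt1// ltr1n.
Qed.

End TopologicalLmodTheory.

Section Tensor.
Context (R : realType) (E F : topologicalLmodType R).

(* A synonym, so that the algebraic tensor product itself carries no topology. *)
Definition tensor : Type := alg_tensor E F.

HB.instance Definition _ := GRing.Lmodule.on tensor.

Definition tens : E -> F -> tensor := @alg_tens R E F.

(* The union over k >= 1 of the sums of the sets tens (U_l x V_l), l = 1, ..., k;
   the sequences are indexed from 0 here. *)
Definition tensor_nbhs0_base (U : nat -> set E) (V : nat -> set F) :
    set tensor :=
  [set t | exists k (x : nat -> E) (y : nat -> F),
    (forall l, (l < k.+1)%N -> U l (x l) /\ V l (y l)) /\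
    t = \sum_(l < k.+1) tens (x l) (y l)].

Definition balanced_nbhs0_seq (G : topologicalLmodType R) (U : nat -> set G) :=
  forall k, nbhs (0 : G) (U k) /\ balanced (U k).

Definition tensor_nbhs (t : tensor) : set_system tensor :=
  [set A | exists (U : nat -> set E) (V : nat -> set F),
    [/\ balanced_nbhs0_seq U, balanced_nbhs0_seq V &
      forall w, tensor_nbhs0_base U V w -> A (t + w)]].

HB.instance Definition _ := hasNbhs.Build tensor tensor_nbhs.

Lemma tens_is_bilinear : bilinear_for *:%R *:%R tens.
Proof. exact: alg_tens_bilinear. Qed.

HB.instance Definition _ := bilinear_isBilinear.Build R E F tensor
  *:%R *:%R tens tens_is_bilinear.

Lemma balanced0 (G : topologicalLmodType R) (U : nat -> set G) k :
  balanced_nbhs0_seq U -> U k 0.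
Proof. by move=> /(_ k)[+ _] => /nbhs_singleton. Qed.

Section Base.
Variables (U : nat -> set E) (V : nat -> set F).
Hypotheses (bU : balanced_nbhs0_seq U) (bV : balanced_nbhs0_seq V).

Lemma tensor_nbhs0_base_sum k (x : nat -> E) (y : nat -> F) :
  (forall l, (l < k)%N -> U l (x l) /\ V l (y l)) ->
  tensor_nbhs0_base U V (\sum_(l < k) tens (x l) (y l)).
Proof.
move=> xy; exists k; pose x' l := if (l < k)%N then x l else 0.
pose y' l := if (l < k)%N then y l else 0; exists x', y'; split=> [l lk|].
  rewrite /x' /y'; case: ifPn => [|_]; first exact: xy.
  by split; exact: balanced0.
rewrite big_ord_recr /= /x' ltnn linear0l addr0; apply: eq_bigr => l _.
by rewrite /y' ltn_ord.
Qed.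

Lemma tensor_nbhs0_base0 : tensor_nbhs0_base U V 0.
Proof.
have := @tensor_nbhs0_base_sum 0 (fun=> 0) (fun=> 0).
by rewrite big_ord0; apply.
Qed.

Lemma tensor_nbhs0_base_widen t : tensor_nbhs0_base U V t ->
  exists k, forall m, (k <= m)%N -> exists (x : nat -> E) (y : nat -> F),
    (forall l, U l (x l) /\ V l (y l)) /\ t = \sum_(l < m) tens (x l) (y l).
Proof.
move=> [k [x [y [xy ->]]]]; exists k.+1 => m km.
pose x' l := if (l < k.+1)%N then x l else 0.
pose y' l := if (l < k.+1)%N then y l else 0; exists x', y'; split=> [l|].
  rewrite /x' /y'; case: ifPn => [|_]; first exact: xy.
  by split; exact: balanced0.
rewrite (big_ord_widen m (fun l => tens (x l) (y l)) km) big_mkcond.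
by apply: eq_bigr => l _; rewrite /x' /y'; case: ifPn => // _; rewrite linear0l.
Qed.

Lemma tensor_nbhs0_base_balanced : balanced (tensor_nbhs0_base U V).
Proof.
move=> a _ a1 [k [x [y [xy ->]]]]; exists k, (fun l => a *: x l), y.
split=> [l /xy[Ux Vy]|]; first by split=> //; exact: (bU l).2.
by rewrite scaler_sumr; apply: eq_bigr => l _; rewrite linearZl_LR.
Qed.

Lemma tensor_nbhs0_base_absorbing (t : tensor) :
  exists2 e : R, 0 < e & forall a, `|a| <= e -> tensor_nbhs0_base U V (a *: t).
Proof.
have [k [x [y tE]]] := alg_tensor_sum t.
suff [e e0 ex] : exists2 e : R, 0 < e & exists y' : nat -> F,
    forall l, (l < k)%N -> exists b, [/\ y l = b *: y' l, V l (y' l) &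
      forall a, `|a| <= e -> U l ((a * b) *: x l)].
  have [y' {}ex] := ex.
  exists e => // a ae.
  have /boolp.choice[b bP] : forall l, exists b, (l < k)%N ->
      [/\ y l = b *: y' l, V l (y' l) &
        forall a, `|a| <= e -> U l ((a * b) *: x l)].
    move=> l; case: (ltnP l k) => [/ex[b ?]|]; first by exists b.
    by exists 0.
  rewrite (_ : _ *: t = \sum_(l < k) tens ((a * b l) *: x l) (y' l)); last first.
    rewrite tE scaler_sumr; apply: eq_bigr => l _.
    have [-> _ _] := bP _ (ltn_ord l).
    by rewrite -[alg_tens _ _]/(tens _ _) linearZr linearZl_LR/= scalerA.
  apply: (@tensor_nbhs0_base_sum k (fun l => (a * b l) *: x l) y') => l.
  by move=> /bP[_ Vy /(_ a ae) Ux].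
suff : forall n, exists2 e : R, 0 < e & exists y' : nat -> F,
    forall l, (l < n)%N -> exists b, [/\ y l = b *: y' l, V l (y' l) &
      forall a, `|a| <= e -> U l ((a * b) *: x l)] by exact.
elim=> [|n [e e0 [y' IH]]]; first by exists 1 => //; exists y.
have [d d0 dV] := nbhs0_absorbing (y n) (bV n).1.
have [c c0 cU] := nbhs0_absorbing (x n) (bU n).1.
exists (Num.min e (c * d)); first by rewrite lt_min e0 mulr_gt0.
exists (fun l => if l == n then d *: y n else y' l) => l.
rewrite ltnS leq_eqVlt; case: eqVneq => [-> _|_ /= /IH[b [yE Vy Ub]]]; last first.
  by exists b; split=> // a; rewrite le_min => /andP[/Ub].
exists d^-1; split; first by rewrite scalerA mulVf ?scale1r// gt_eqF.
  by apply: dV; rewrite gtr0_norm.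
move=> a; rewrite le_min => /andP[_ acd]; apply: cU.
by rewrite normrM normfV (gtr0_norm d0) ler_pdivrMr.
Qed.

End Base.

Lemma balanced_nbhs0_seqI (G : topologicalLmodType R) (U V : nat -> set G) :
  balanced_nbhs0_seq U -> balanced_nbhs0_seq V ->
  balanced_nbhs0_seq (fun k => U k `&` V k).
Proof.
move=> bU bV k; have [nU kU] := bU k; have [nV kV] := bV k.
split; first exact: filterI.
by move=> a x a1 [Ux Vx]; split; [exact: kU|exact: kV].
Qed.

Lemma tensor_nbhs0_baseS U V U' V' :
  (forall k, U k `<=` U' k) -> (forall k, V k `<=` V' k) ->
  tensor_nbhs0_base U V `<=` tensor_nbhs0_base U' V'.
Proof.
move=> UU VV _ [k [x [y [xy ->]]]]; exists k, x, y; split=> // l /xy[Ux Vy].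
by split; [exact: UU|exact: VV].
Qed.

Definition half_seq (G : Type) (U : nat -> set G) k := U k.*2 `&` U k.*2.+1.

Lemma half_seq_balanced (G : topologicalLmodType R) (U : nat -> set G) :
  balanced_nbhs0_seq U -> balanced_nbhs0_seq (half_seq U).
Proof.
move=> bU.
exact: (@balanced_nbhs0_seqI _ (fun k => U k.*2) (fun k => U k.*2.+1)).
Qed.

Lemma tensor_nbhs0_base_split U V w w' :
  balanced_nbhs0_seq U -> balanced_nbhs0_seq V ->
  tensor_nbhs0_base (half_seq U) (half_seq V) w ->
  tensor_nbhs0_base (half_seq U) (half_seq V) w' ->
  tensor_nbhs0_base U V (w + w').
Proof.
move=> bU bV; have bU' := half_seq_balanced bU; have bV' := half_seq_balanced bV.
move=> /(tensor_nbhs0_base_widen bU' bV')[k kP].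
move=> /(tensor_nbhs0_base_widen bU' bV')[k' kP'].
have [x [y [xy ->]]] := kP _ (leq_maxl k k').
have [x' [y' [xy' ->]]] := kP' _ (leq_maxr k k').
pose mix (T : Type) (u v : nat -> T) l := if odd l then v l./2 else u l./2.
rewrite (_ : _ + _ =
    \sum_(l < (maxn k k').*2) tens (mix _ x x' l) (mix _ y y' l)); last first.
  elim: (maxn k k') => [|m IH]; first by rewrite !big_ord0 addr0.
  rewrite doubleS !big_ord_recr /= -IH addrACA /mix /= odd_double /=.
  by rewrite doubleK uphalf_double !addrA.
have := @tensor_nbhs0_base_sum _ _ bU bV (maxn k k').*2 (mix _ x x') (mix _ y y').
apply=> l _.
rewrite /mix; have lE := odd_double_half l; case: (odd l) lE => /= lE.
  have [[_ Ux] [_ Vy]] := xy' l./2.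
  by rewrite add1n in lE; rewrite lE in Ux Vy.
have [[Ux _] [Vy _]] := xy l./2.
by rewrite add0n in lE; rewrite lE in Ux Vy.
Qed.

Let setT_balanced (G : topologicalLmodType R) :
  balanced_nbhs0_seq (fun=> [set: G]).
Proof. by move=> k; split=> //; exact: filterT. Qed.

Lemma tensor_nbhs_filter t : ProperFilter (tensor_nbhs t).
Proof.
split; first by move=> [U [V [bU bV]]] /(_ _ (tensor_nbhs0_base0 bU bV)).
split.
- by exists (fun=> setT), (fun=> setT).
- move=> A B [U [V [bU bV UVA]]] [U' [V' [bU' bV' UVB]]].
  exists (fun k => U k `&` U' k), (fun k => V k `&` V' k).
  split; [exact: balanced_nbhs0_seqI|exact: balanced_nbhs0_seqI|] => w Ww.
  split; [apply: UVA|apply: UVB]; apply: tensor_nbhs0_baseS Ww => k;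
    by [exact: subIsetl|exact: subIsetr].
- move=> A B AB [U [V [bU bV UVA]]]; exists U, V; split=> // w /UVA; exact: AB.
Qed.

Lemma tensor_nbhs_singleton t (A : set tensor) : tensor_nbhs t A -> A t.
Proof.
by move=> [U [V [bU bV /(_ _ (tensor_nbhs0_base0 bU bV))]]]; rewrite addr0.
Qed.

Lemma tensor_nbhs_nbhs t (A : set tensor) :
  tensor_nbhs t A -> tensor_nbhs t (tensor_nbhs^~ A).
Proof.
move=> [U [V [bU bV UVA]]]; exists (half_seq U), (half_seq V).
split; [exact: half_seq_balanced|exact: half_seq_balanced|] => w Ww.
exists (half_seq U), (half_seq V).
split; [exact: half_seq_balanced|exact: half_seq_balanced|] => w' Ww'.
by rewrite -addrA; apply: UVA; exact: tensor_nbhs0_base_split.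
Qed.

HB.instance Definition _ := Nbhs_isNbhsTopological.Build tensor
  tensor_nbhs_filter tensor_nbhs_singleton tensor_nbhs_nbhs.

Lemma tensor_add_continuous :
  continuous (fun x : tensor * tensor => x.1 + x.2).
Proof.
move=> [t t'] A /= [U [V [bU bV UVA]]].
have [bU' bV'] := (half_seq_balanced bU, half_seq_balanced bV).
pose W := tensor_nbhs0_base (half_seq U) (half_seq V).
exists ([set w | W (w - t)], [set w | W (w - t')]) => /=.
  by split; exists (half_seq U), (half_seq V); split=> // w; rewrite /= addrC addKr.
move=> [w w'] /= [Ww Ww'].
rewrite -[w](subrK t) -[w'](subrK t') addrACA addrC.
by apply: UVA; exact: tensor_nbhs0_base_split.
Qed.

Lemma tensor_nbhs0_base_scale U V (a : R) :
  balanced_nbhs0_seq U -> balanced_nbhs0_seq V ->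
  exists U' V', [/\ balanced_nbhs0_seq U', balanced_nbhs0_seq V' &
    forall b w, `|b| <= a -> tensor_nbhs0_base U' V' w ->
      tensor_nbhs0_base U V (b *: w)].
Proof.
move=> bU bV; exists (fun k => [set x | U k (a *: x)]), V; split=> //.
  move=> k; split; first exact: nbhs0_scale (bU k).1.
  by move=> b x b1 /= Ux; rewrite scalerA mulrC -scalerA; exact: (bU k).2.
move=> b _ ba [k [x [y [xy ->]]]]; exists k, (fun l => b *: x l), y.
split=> [l /xy[/= Ux Vy]|]; last first.
  by rewrite scaler_sumr; apply: eq_bigr => l _; rewrite linearZl_LR.
split=> //; have [a0|a0] := eqVneq a 0.
  move: ba; rewrite a0 normr_le0 => /eqP ->; rewrite scale0r; exact: balanced0.
have -> : b *: x l = (b / a) *: (a *: x l) by rewrite scalerA divfK.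
apply: (bU l).2 => //; rewrite normrM normfV.
have a1 : 0 < a by rewrite lt_neqAle eq_sym a0 (le_trans _ ba).
by rewrite (gtr0_norm a1) ler_pdivrMr// mul1r.
Qed.

Lemma tensor_scale_continuous :
  continuous (fun z : R^o * tensor => z.1 *: z.2).
Proof.
move=> [a t] A /= [U [V [bU bV UVA]]].
have [bU' bV'] := (half_seq_balanced bU, half_seq_balanced bV).
have [U1 [V1 [bU1 bV1 W1]]] := tensor_nbhs0_base_scale (`|a| + 1) bU' bV'.
have [e e0 eW] := tensor_nbhs0_base_absorbing bU' bV' t.
pose W := tensor_nbhs0_base U1 V1.
exists (ball (a : R^o) (Num.min e 1), [set w | W (w - t)]) => /=.
  split; first by apply: nbhsx_ballx; rewrite lt_min e0/=.
  by exists U1, V1; split=> // w; rewrite /= addrC addKr.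
move=> [b w] /= [ab Ww].
have {ab} [abe ab1] : `|b - a| < e /\ `|b - a| < 1.
  by move: ab; rewrite /ball /= distrC lt_min => /andP.
have -> : b *: w = a *: t + ((b - a) *: t + b *: (w - t)).
  by rewrite addrA -scalerDl [a + _]addrC subrK -scalerDr [t + _]addrC subrK.
apply: UVA; apply: tensor_nbhs0_base_split => //; first exact/eW/ltW.
apply: W1 => //; rewrite -[b](subrK a) addrC (le_trans (ler_normD _ _))//.
by rewrite lerD2l ltW.
Qed.

HB.instance Definition _ :=
  PreTopologicalNmodule_isTopologicalNmodule.Build tensor tensor_add_continuous.
HB.instance Definition _ :=
  TopologicalNmodule_isTopologicalLmodule.Build R tensor tensor_scale_continuous.

End Tensor.

Section SequenceSpace.
Context (R : realType).

(* The index set {1, 2, ...} is replaced by [nat]. *)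
Definition RN := prod_topology (fun _ : nat => R^o).

HB.instance Definition _ := Topological.on RN.
HB.instance Definition _ := GRing.Lmodule.copy RN (nat -> R^o).

Lemma continuous_RN (X : topologicalType) (f : X -> RN) :
  (forall i, continuous (fun x => f x i)) -> continuous f.
Proof.
move=> fc x; apply/cvg_sup => i N [V [[W oW <-] Wfx WN]].
by apply: filterS WN _; apply: fc; exact: open_nbhs_nbhs.
Qed.

Lemma RN_coord_nbhs i (x : RN) (A : set R^o) :
  nbhs (x i : R^o) A -> nbhs x [set y : RN | A (y i)].
Proof. exact: (@proj_continuous nat (fun=> R^o) i x). Qed.

Lemma RN_add_continuous : continuous (fun x : RN * RN => x.1 + x.2).
Proof.
apply: continuous_RN => i [x y] A.
move=> /(@add_continuous R^o (x i, y i))[[P Q] [/= nP nQ] PQ].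
exists ([set z : RN | P (z i)], [set z : RN | Q (z i)]).
  by split; exact: RN_coord_nbhs.
by move=> [z w] [/= Pz Qw]; exact: (PQ (z i, w i)).
Qed.

Lemma RN_scale_continuous : continuous (fun z : R^o * RN => z.1 *: z.2).
Proof.
apply: continuous_RN => i [a x] A.
move=> /(@scale_continuous R R^o (a, x i))[[P Q] [/= nP nQ] PQ].
exists (P, [set z : RN | Q (z i)]); first by split=> //; exact: RN_coord_nbhs.
by move=> [b z] [/= Pb Qz]; exact: (PQ (b, z i)).
Qed.

HB.instance Definition _ :=
  PreTopologicalNmodule_isTopologicalNmodule.Build RN RN_add_continuous.
HB.instance Definition _ :=
  TopologicalNmodule_isTopologicalLmodule.Build R RN RN_scale_continuous.

End SequenceSpace.

Definition biadditive (U V W : zmodType) (f : U -> V -> W) :=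
  (forall y, zmod_morphism (f^~ y)) /\ (forall x, zmod_morphism (f x)).

(* [tau] makes [T] a tensor product of [E] and [F] in the class [A]. *)
Definition is_tvs_tensor (R : realType) (A : topologicalLmodType R -> Prop)
    (E F T : topologicalLmodType R) (tau : E -> F -> T) : Prop :=
  [/\ A E, A F & A T] /\
  [/\ bilinear_for *:%R *:%R tau, continuous (fun p : E * F => tau p.1 p.2) &
    forall (G : topologicalLmodType R) (f : E -> F -> G), A G ->
      bilinear_for *:%R *:%R f -> continuous (fun p : E * F => f p.1 p.2) ->
      exists! g : T -> G,
        [/\ linear g, continuous g & forall x y, g (tau x y) = f x y]].

Definition is_group_tensor (A : topologicalZmodType -> Prop)
    (E F T : topologicalZmodType) (tau : E -> F -> T) : Prop :=
  [/\ A E, A F & A T] /\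
  [/\ biadditive tau, continuous (fun p : E * F => tau p.1 p.2) &
    forall (G : topologicalZmodType) (f : E -> F -> G), A G ->
      biadditive f -> continuous (fun p : E * F => f p.1 p.2) ->
      exists! g : T -> G,
        [/\ zmod_morphism g, continuous g & forall x y, g (tau x y) = f x y]].

(* Completeness is meant for the uniform structure with entourages
   [{(x, y) | x - y \in U}], U a neighbourhood of 0. *)
Definition cauchy_filter (G : topologicalZmodType) (F : set_system G) :=
  forall U, nbhs (0 : G) U ->
    exists2 A, F A & forall x y, A x -> A y -> U (x - y).

Definition complete_group (G : topologicalZmodType) :=
  forall F : set_system G, ProperFilter F -> cauchy_filter F ->
    exists x : G, F --> x.

Definition hausdorff_tvs (R : realType) (E : topologicalLmodType R) :=
  hausdorff_space E.

Definition complete_hausdorff_tvs (R : realType) (E : topologicalLmodType R) :=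
  hausdorff_space E /\ complete_group E.

Definition hausdorff_group (G : topologicalZmodType) := hausdorff_space G.

Definition tvs_iso (R : realType) (E F : topologicalLmodType R) (f : E -> F) :=
  [/\ linear f, continuous f & exists g : F -> E,
    [/\ linear g, continuous g, cancel f g & cancel g f]].

Definition group_iso (G H : topologicalZmodType) (f : G -> H) :=
  [/\ zmod_morphism f, continuous f & exists g : H -> G,
    [/\ zmod_morphism g, continuous g, cancel f g & cancel g f]].

Section TensorUniversal.
Context (R : realType) (E F : topologicalLmodType R).

Lemma tens_continuous : continuous (fun p : E * F => tens p.1 p.2).
Proof.
move=> [x0 y0] A /= [U [V [bU bV UVA]]].
have [c c0 cV] := nbhs0_absorbing y0 (bV 0%N).1.
have [d d0 dU] := nbhs0_absorbing x0 (bU 1%N).1.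
pose P := [set x | U 0%N (c^-1 *: x) /\ U 2%N x].
pose Q := [set y | V 1%N (d^-1 *: y) /\ V 2%N y].
have nP : nbhs (0 : E) P.
  by apply: filterI; [exact: nbhs0_scale (bU _).1|exact: (bU _).1].
have nQ : nbhs (0 : F) Q.
  by apply: filterI; [exact: nbhs0_scale (bV _).1|exact: (bV _).1].
exists ([set x | P (x - x0)], [set y | Q (y - y0)]) => /=.
  split; apply/nbhs_translate; [apply: filterS nP|apply: filterS nQ] => z /=;
    by rewrite [_ + z]addrC addrK.
move=> [x y] /= [[U0 U2] [V1 V2]].
have -> : tens x y = tens x0 y0 + (tens (x - x0) y0 + tens x0 (y - y0)
    + tens (x - x0) (y - y0)).
  move: (x - x0) (subrK x0 x) => dx <-; move: (y - y0) (subrK y0 y) => dy <-.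
  have tDl (u u' : E) (v : F) : tens (u + u') v = tens u v + tens u' v.
    exact: linearDl.
  have tDr (u : E) (v v' : F) : tens u (v + v') = tens u v + tens u v'.
    exact: linearDr.
  rewrite tDl !tDr [tens dx dy + _]addrC addrACA addrA.
  exact: addrC.
apply: UVA.
pose xs l := nth 0 [:: c^-1 *: (x - x0); d *: x0; x - x0] l.
pose ys l := nth 0 [:: c *: y0; d^-1 *: (y - y0); y - y0] l.
have := @tensor_nbhs0_base_sum _ _ _ _ _ bU bV 3 xs ys.
rewrite !big_ord_recr big_ord0 /= add0r /xs /ys /= !linearZl_LR !linearZr /=.
rewrite !scalerA mulVf ?gt_eqF// mulfV ?gt_eqF// !scale1r; apply.
move=> [|[|[|l]]]//= _; split=> //.
  by apply: cV; rewrite gtr0_norm.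
by apply: dU; rewrite gtr0_norm.
Qed.

Lemma tensor_lift_continuous (G : topologicalLmodType R) (f : E -> F -> G) :
  bilinear_for *:%R *:%R f -> continuous (fun p : E * F => f p.1 p.2) ->
  continuous (tensor_lift f : tensor E F -> G).
Proof.
move=> bf cf t A /= /nbhs_translate nA.
have /boolp.choice[h hP] : forall U : set G, exists V : set G,
    nbhs (0 : G) U ->
    nbhs (0 : G) V /\ forall x y, V x -> V y -> U (x + y).
  move=> U; have [/nbhs0_split[V nV VU]|nU] := pselect (nbhs (0 : G) U).
    by exists V.
  by exists setT.
pose S n := iter n h [set v | A (tensor_lift f t + v)].
have nS n : nbhs (0 : G) (S n) by elim: n => // n /hP[].
have Ssum k : forall n (s : nat -> G),
    (forall l, (l < k)%N -> S (n + l).+1 (s l)) -> S n (\sum_(l < k) s l).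
  elim: k => [|k IH] n s sS.
    by rewrite big_ord0; exact: nbhs_singleton.
  rewrite big_ord_recl /=; apply: (hP _ (nS n)).2.
    by have := sS 0%N isT; rewrite addn0.
  by apply: (IH n.+1 (fun l => s l.+1)) => l lk; have := sS l.+1 lk; rewrite addnS -addSn.
have /boolp.choice[W WP] : forall n, exists W : set E * set F,
    [/\ nbhs (0 : E) W.1 /\ balanced W.1, nbhs (0 : F) W.2 /\ balanced W.2 &
      forall x y, W.1 x -> W.2 y -> S n.+1 (f x y)].
  move=> n; have := cf (0, 0) (S n.+1).
  have f00 : f 0 0 = 0.
    pose L := GRing.isLinear.Build R F G *:%R _ (bf.2 0).
    by pose f0 : {linear F -> G} := HB.pack (f 0) L; exact: (linear0 f0).
  rewrite [f (0, 0).1 _]f00 => /(_ (nS n.+1)) [[P Q] [/= nP nQ] PQ].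
  have [P' bP PP] := nbhs0_balanced nP; have [Q' bQ QQ] := nbhs0_balanced nQ.
  by exists (P', Q'); split=> // x y /PP Px /QQ Qy; exact: (PQ (x, y)).
exists (fun n => (W n).1), (fun n => (W n).2).
split; [by move=> k; case: (WP k)|by move=> k; case: (WP k)|].
move=> _ [k [x [y [xy ->]]]] /=.
pose L := GRing.isLinear.Build _ _ _ _ _ (tensor_lift_linear bf).
pose g : {linear alg_tensor E F -> G} := HB.pack (tensor_lift f) L.
rewrite -[tensor_lift f _]/(g _) linearD linear_sum /=.
rewrite (eq_bigr (fun l : 'I_k.+1 => f (x l) (y l))); last first.
  by move=> l _; exact: tensor_liftE.
apply: (Ssum k.+1 0%N (fun l => f (x l) (y l))) => l /xy[Wx Wy].
by have [_ _] := WP l; exact.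
Qed.

(* [tensor E F] is the tensor product in the class of all real topological
   vector spaces. *)
Lemma tensor_is_tvs_tensor : is_tvs_tensor (fun=> True) (@tens R E F).
Proof.
split=> //; split; [exact: tens_is_bilinear|exact: tens_continuous|].
move=> G f _ bf cf; exists (tensor_lift f); split.
  split; [exact: tensor_lift_linear|exact: tensor_lift_continuous|].
  exact: tensor_liftE.
move=> g [lg _ gE]; apply/funext => t.
pose g' : {linear alg_tensor E F -> G} := HB.pack g (GRing.isLinear.Build _ _ _ _ _ lg).
pose L := GRing.isLinear.Build _ _ _ _ _ (tensor_lift_linear bf).
pose f' : {linear alg_tensor E F -> G} := HB.pack (tensor_lift f) L.
have [k [x [y ->]]] := alg_tensor_sum t.
rewrite -[RHS]/(g' _) -[LHS]/(f' _) !linear_sum; apply: eq_bigr => l _.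
by rewrite /= tensor_liftE// gE.
Qed.

End TensorUniversal.

(* Main.v *)
Require Import Defs.
From HB Require Import structures.
From mathcomp Require Import all_boot all_order all_algebra.
From mathcomp Require Import sesquilinear generic_quotient ring_quotient freeg.
From mathcomp Require Import boolp classical_sets functions reals topology.
From mathcomp Require Import num_normedtype pseudometric_normed_Zmodule tvs.
From mathcomp Require Import normed_module.
From mathcomp Require Import complete_normed_module matrix_normedtype zify.

Set Implicit Arguments.
Unset Strict Implicit.
Unset Printing Implicit Defensive.

Import Order.TTheory GRing.Theory Num.Theory.
Import numFieldTopology.Exports.
Local Open Scope classical_set_scope.
Local Open Scope ring_scope.

(* An element [t] of E (x) F, E = R^N, is determined by its coordinates [t_i] in F,
   and a neighbourhood of 0 consists of sums of sequences [x_l (x) v_l] of rank one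
   whose coordinates [i < n_l] lie in [V_l]. Hence E (x) F is Hausdorff if F is.
   If F is complete, a Cauchy filter on E (x) F converges coordinatewise to some
   [v] in F^N. This [v] has finite rank, as on finitely many coordinates it is
   close to sequences of small rank, and the rank is lower semicontinuous. The
   filter converges to [v], as every neighbourhood of 0 contains the coordinatewise
   closure of another one.
   A continuous biadditive map to a Hausdorff group satisfies f(ax, y) = f(x, ay),
   as this holds for rational [a], so it factors through the tensor product
   over R.
   The neighbourhoods of 0 in (E (x) E) (x) E contain [a (x) e_p] for some [p] and
   all [a], which is not so in E (x) (E (x) E): see [tensor_RN_not_assoc]. *)

(** * Strings of sets: [T n.+1 + T n.+1] is contained in [T n] *)

Section StringTheory.
Context (G : zmodType) (T : nat -> set G).
Hypothesis T0 : forall n, T n 0.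
Hypothesis TD : forall n x y, T n.+1 x -> T n.+1 y -> T n (x + y).

Lemma string_decr m n : (m <= n)%N -> T n `<=` T m.
Proof.
move=> /subnK <-; elim: (n - m)%N => // k IH x; rewrite addSn => Tx.
by apply: IH; rewrite -[x]addr0; apply: TD => //; exact: T0.
Qed.

(** By induction the terms after the first sum to an element of [T n.+1], which leaves a single use
    of [TD]. Thus finite sums of any length stay in [T n]. *)
Lemma string_sum k n (s : nat -> G) :
  (forall l, (l < k)%N -> T (n + l).+1 (s l)) -> T n (\sum_(l < k) s l).
Proof.
elim: k n s => [|k IH] n s sT; first by rewrite big_ord0; exact: T0.
rewrite big_ord_recl /=; apply: TD; first by have := sT 0%N isT; rewrite addn0.
by apply: (IH n.+1 (fun l => s l.+1)) => l lk; have := sT l.+1 lk; rewrite addnS -addSn.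
Qed.

End StringTheory.

Section Strings.
Context (R : realType) (G : topologicalLmodType R).

Lemma nbhs0_string (Q : nat -> set G) : (forall n, nbhs (0 : G) (Q n)) ->
  exists T : nat -> set G, [/\ balanced_nbhs0_seq T, forall n, T n `<=` Q n &
    forall n x y, T n.+1 x -> T n.+1 y -> T n (x + y)].
Proof.
move=> nQ.
have /boolp.choice[h hP] : forall U : set G, exists V : set G,
    nbhs (0 : G) U ->
    [/\ nbhs (0 : G) V, balanced V & forall x y, V x -> V y -> U (x + y)].
  move=> U; have [/nbhs0_split[V nV VU]|nU] := pselect (nbhs (0 : G) U).
    have [W [nW bW] WV] := nbhs0_balanced nV.
    by exists W => _; split=> // x y /WV Vx /WV Vy; exact: VU.
  by exists setT.
(* Each set halves the intersection of its predecessor with [Q n]; as all of them contain 0, halving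
   also yields the inclusions. *)
pose fix T n := h (if n is n'.+1 then T n' `&` Q n else Q n).
have nT n : nbhs (0 : G) (T n).
  by elim: n => [|n IH] /=; [have [] := hP _ (nQ 0)|have [] := hP _ (filterI IH (nQ n.+1))].
exists T; split.
- move=> [|n] /=; split=> //; try exact: (nT n.+1); try exact: (nT 0).
    by have [] := hP _ (nQ 0).
  by have [] := hP _ (filterI (nT n) (nQ n.+1)).
- move=> [|n] x Tx; rewrite -[x]addr0.
    by have [_ _] := hP _ (nQ 0); apply=> //; exact: nbhs_singleton (nT 0).
  have [_ _ hS] := hP _ (filterI (nT n) (nQ n.+1)).
  by have [] := hS x 0 Tx (nbhs_singleton (nT n.+1)).
move=> n x y Tx Ty; have [_ _ hS] := hP _ (filterI (nT n) (nQ n.+1)).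
by have [] := hS x y Tx Ty.
Qed.

End Strings.

(** * Zero-neighbourhoods and completeness of R^N *)

Section SequenceSpaceTheory.
Context (R : realType).

Definition RN_e (i : nat) : RN R := fun j => (j == i)%:R.

Definition RN_tail n (x : RN R) : RN R := fun i => if (i < n)%N then 0 else x i.

Definition RN_box n : set (RN R) := [set x | forall i, (i < n)%N -> `|x i| <= 1].

Lemma RN_addE (x y : RN R) i : (x + y) i = x i + y i. Proof. by []. Qed.

Lemma RN_scaleE a (x : RN R) i : (a *: x) i = a * x i. Proof. by []. Qed.

Lemma RN_sumE k (x : 'I_k -> RN R) i : (\sum_l x l) i = \sum_l x l i.
Proof.
elim: k x => [|k IH] x; first by rewrite !big_ord0.
rewrite big_ord_recr [RHS]big_ord_recr; exact: (congr2 +%R (IH _) erefl).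
Qed.

Lemma RN_tailE n (x : RN R) : x = \sum_(i < n) x i *: RN_e i + RN_tail n x.
Proof.
apply/funext => j; rewrite RN_addE RN_sumE /RN_tail; case: ltnP => jn.
  rewrite addr0 (bigD1 (Ordinal jn))//= big1 ?addr0 => [|i].
    by rewrite RN_scaleE /RN_e eqxx mulr1.
  by rewrite -val_eqE /= RN_scaleE /RN_e eq_sym => /negPf ->; rewrite mulr0.
rewrite big1 ?add0r// => i _; rewrite RN_scaleE /RN_e.
by rewrite gtn_eqF ?mulr0// (leq_trans _ jn).
Qed.

(** The sets admitting such an [n] form a filter, which converges to 0 because along it each
    coordinate is eventually equal to 0. *)
Lemma RN_nbhs0_tail (U : set (RN R)) : nbhs (0 : RN R) U ->
  exists n, forall x : RN R, (forall i, (i < n)%N -> x i = 0) -> U x.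
Proof.
pose Phi : set_system (RN R) := [set A |
  exists n, forall x : RN R, (forall i, (i < n)%N -> x i = 0) -> A x].
have FPhi : Filter Phi.
  split; first by exists 0%N.
  - move=> A B [m Am] [n Bn]; exists (maxn m n) => x x0; split.
      by apply: Am => i im; rewrite x0// leq_max im.
    by apply: Bn => i im; rewrite x0// leq_max im orbT.
  - by move=> A B AB [n An]; exists n => x /An /AB.
suff : Phi --> (0 : RN R) by exact.
apply/cvg_sup => i N [V [[W oW <-] W0 WN]].
by exists i.+1 => x xi; apply: WN; rewrite /= xi.
Qed.

Lemma RN_box_nbhs0 n : nbhs (0 : RN R) (RN_box n).
Proof.
elim: n => [|n IH]; first by apply: filterS filterT => x _ i.
have n1 : nbhs (0 : RN R) [set x : RN R | `|x n : R| <= 1].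
  apply: (@RN_coord_nbhs R n 0 [set z : R^o | `|z| <= 1]).
  apply/nbhs_ballP; exists 1 => //= z; rewrite /ball /= sub0r normrN; exact: ltW.
apply: filterS (filterI IH n1) => x [xn x1] i.
by rewrite ltnS leq_eqVlt => /predU1P[->//|]; exact: xn.
Qed.

Lemma RN_box_balanced n : balanced (RN_box n).
Proof.
by move=> a x a1 xn i /xn xi; rewrite RN_scaleE normrM mulr_ile1.
Qed.

Lemma RN_box_seq (N : nat -> nat) : balanced_nbhs0_seq (fun l => RN_box (N l)).
Proof. by move=> l; split; [exact: RN_box_nbhs0|exact: RN_box_balanced]. Qed.

Lemma RN_hausdorff : hausdorff_space (RN R).
Proof. by apply: hausdorff_product => _; exact: Rhausdorff. Qed.

Lemma RN_complete : complete_group (RN R).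
Proof.
move=> Phi PPhi cPhi.
have /boolp.choice[x xP] i : exists xi : R^o, (fun x : RN R => x i : R^o) @ Phi --> xi.
  set Phi_i := (_ @ Phi); have PPhi_i : ProperFilter Phi_i by exact: fmap_proper_filter.
  apply/cvg_ex; apply: (@R_complete R Phi_i PPhi_i); apply: (@cauchy_exP R R^o Phi_i) => e e0.
  have [A PA AA] := cPhi [set x : RN R | ball (0 : R^o) e (x i)]
    (@RN_coord_nbhs R i 0 _ (nbhsx_ballx (0 : R^o) e e0)).
  have [a Aa] := filter_ex PA; exists (a i : R^o).
  apply: (@filterS _ Phi _ A) PA => y Ay.
  by have := AA _ _ Ay Aa; rewrite /= /ball /= sub0r normrN distrC.
exists x; apply/cvg_sup => i N [V [[W oW <-] Wx WN]].
by apply: filterS WN _; apply: xP; exact: open_nbhs_nbhs.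
Qed.

End SequenceSpaceTheory.

(** * Coordinates of elements of E (x) F, where E = R^N *)

Section Coordinates.
Context (R : realType) (F : topologicalLmodType R).
Local Notation E := (RN R).

Let coord_bilin i : bilinear_for *:%R *:%R (fun (x : E) (y : F) => x i *: y).
Proof.
split=> [y a x x'|x a y y'] /=; first by rewrite RN_addE RN_scaleE scalerDl scalerA.
by rewrite scalerDr !scalerA mulrC.
Qed.

(** Contraction with the [i]-th coordinate functional of R^N. *)
Definition tcoord i : tensor E F -> F := tensor_lift (fun (x : E) (y : F) => x i *: y).

Lemma tcoord_is_linear i : linear (tcoord i).
Proof. exact: tensor_lift_linear (coord_bilin i). Qed.

HB.instance Definition _ i :=
  GRing.isLinear.Build R (tensor E F) F *:%R (tcoord i) (tcoord_is_linear i).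

Lemma tcoord_tens i x y : tcoord i (tens x y) = x i *: y.
Proof. exact: tensor_liftE (coord_bilin i) x y. Qed.

Lemma tcoord_sum i k (x : 'I_k -> E) (y : 'I_k -> F) :
  tcoord i (\sum_l tens (x l) (y l)) = \sum_l x l i *: y l.
Proof. by rewrite linear_sum; apply: eq_bigr => l _; exact: tcoord_tens. Qed.

Lemma tcoord_continuous i : continuous (tcoord i).
Proof.
apply: tensor_lift_continuous (coord_bilin i) _ => -[x y] A.
move=> /(@scale_continuous R F (x i, y))[[P Q] [/= nP nQ] PQ].
exists ([set z : E | P (z i)], Q); first by split=> //; exact: RN_coord_nbhs.
by move=> [z w] [/= Pz Qw]; exact: (PQ (z i, w)).
Qed.

Lemma tensor_rank_sum (t : tensor E F) :
  exists k (x : 'I_k -> E) (y : 'I_k -> F), t = \sum_l tens (x l) (y l).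
Proof.
by have [k [x [y tE]]] := alg_tensor_sum t; exists k, (fun l => x l), (fun l => y l).
Qed.

(** Induction on the number of terms: if the first [x] has a nonzero coordinate [i], the vanishing
    of coordinate [i] of [t] expresses the first [y] through the others, which removes one term. *)
Lemma tcoord_inj t : (forall i, tcoord i t = 0) -> t = 0.
Proof.
have [k [x [y ->]]] := tensor_rank_sum t.
elim: k x y => [|k IH] x y t0; first by rewrite big_ord0.
have [x0|/existsNP[i /eqP xi]] := pselect (forall i, x ord0 i = 0).
  have x00 : x ord0 = 0 by apply/funext.
  rewrite big_ord_recl x00 linear0l add0r; apply: IH => i.
  by have := t0 i; rewrite big_ord_recl x00 linear0l add0r.
have tE : \sum_l tens (x l) (y l) =
    \sum_(l < k) tens (x (fintype.lift ord0 l) - (x (fintype.lift ord0 l) i / x ord0 i) *: x ord0)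
                      (y (fintype.lift ord0 l)).
  have := t0 i; rewrite tcoord_sum big_ord_recl => /eqP; rewrite addr_eq0 => /eqP yE.
  rewrite big_ord_recl.
  have -> : y ord0 = - \sum_(l < k) (x (fintype.lift ord0 l) i / x ord0 i) *:
      y (fintype.lift ord0 l).
    rewrite -[LHS](scalerK xi) yE scalerN scaler_sumr; congr (- _).
    by apply: eq_bigr => l _; rewrite scalerA mulrC.
  rewrite linearNr linear_sumr -sumrN -big_split.
  apply: eq_bigr => l _ /=.
  by rewrite linearBl linearZl_LR linearZr_LR addrC.
by rewrite tE; apply: IH => j; rewrite -tE.
Qed.

(** The coordinates are continuous and separate points. *)
Lemma tensor_RN_hausdorff : hausdorff_space F -> hausdorff_space (tensor E F).
Proof.
move=> hF s t st; apply/eqP; rewrite -subr_eq0; apply/eqP/tcoord_inj => i.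
rewrite linearB; apply/eqP; rewrite subr_eq0; apply/eqP/hF => A B nA nB.
have [u [Au Bu]] := st _ _ (tcoord_continuous nA) (tcoord_continuous nB).
by exists (tcoord i u).
Qed.

Lemma tens_scaleK (X Y : topologicalLmodType R) a (x : X) (y : Y) :
  a != 0 -> tens (a *: x) (a^-1 *: y) = tens x y.
Proof. by move=> a0; rewrite linearZl_LR linearZr_LR /= scalerA divff// scale1r. Qed.

Lemma sum_tensB k (x x' : 'I_k -> E) (y y' : 'I_k -> F) :
  exists xs ys, \sum_l tens (x l) (y l) - \sum_l tens (x' l) (y' l) =
    \sum_(l < k + k) tens (xs l) (ys l).
Proof.
exists (fun l => match fintype.split l with inl j => x j | inr j => x' j end).
exists (fun l => match fintype.split l with inl j => y j | inr j => - y' j end).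
rewrite big_split_ord /= -sumrN; congr (_ + _); apply: eq_bigr => j _.
  by rewrite (unsplitK (inl j)).
by rewrite (unsplitK (inr j)) linearNr.
Qed.

(** Expand each [x l] along the first [N] unit vectors; collecting the terms with the same unit
    vector [RN_e R i] gives coordinate [i] of the whole sum. *)
Lemma sum_tens_truncate N k (x : 'I_k -> E) (y : 'I_k -> F) :
  \sum_l tens (x l) (y l) =
  \sum_(i < N) tens (RN_e R i) (tcoord i (\sum_l tens (x l) (y l))) +
  \sum_l tens (RN_tail N (x l)) (y l).
Proof.
under [X in _ = X + _]eq_bigr => i _ do rewrite tcoord_sum linear_sumr.
rewrite exchange_big -big_split; apply: eq_bigr => l _ /=.
rewrite [in LHS](RN_tailE N (x l)) linearDl linear_sumlz; congr (_ + _).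
by apply: eq_bigr => i _; rewrite linearZl_LR linearZr_LR.
Qed.

End Coordinates.

(** * Coordinatewise closures of the basic zero-neighbourhoods *)

Section Closure.
Context (R : realType) (F : topologicalLmodType R).
Local Notation E := (RN R).
Implicit Types (U : nat -> set E) (V T : nat -> set F).

(* The sets [tensor_nbhs0_base U V] with [U l] and [V l] contained in
   [RN_box (N l)] and [T l.+2]: only the terms [l < K] of an element can have
   coordinates [i < N K] outside of [T K.+1]. *)
Lemma tensor_nbhs0_base_head N T K U V w :
  balanced_nbhs0_seq U -> balanced_nbhs0_seq V ->
  balanced_nbhs0_seq T -> (forall n x y, T n.+1 x -> T n.+1 y -> T n (x + y)) ->
  {homo N : m n / (m <= n)%N} ->
  (forall l, U l `<=` RN_box (N l)) -> (forall l, V l `<=` T l.+2) ->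
  tensor_nbhs0_base U V w ->
  exists (x : nat -> E) (y : nat -> F), (forall l, U l (x l) /\ V l (y l)) /\
    forall i, (i < N K)%N -> T K.+1 (tcoord i (w - \sum_(l < K) tens (x l) (y l))).
Proof.
move=> bU bV bT TD Nh UN VT /(tensor_nbhs0_base_widen bU bV)[k kP].
have [x [y [xy ->]]] := kP _ (leq_addl K k); exists x, y; split=> // i iK.
rewrite big_split_ord /= addrAC subrr add0r tcoord_sum /=.
apply: (@string_sum _ T (fun n => balanced0 n bT) TD k K.+1
  (fun l => x (K + l)%N i *: y (K + l)%N)) => l _.
rewrite addSn; apply: (bT _).2; last exact: VT (xy _).2.
apply: UN (xy (K + l)%N).1 _ _; apply: leq_trans iK _; apply: Nh; exact: leq_addr.
Qed.

(** The closure for the topology induced from the product F^N by the coordinates. *)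
Definition coord_closure (W : set (tensor E F)) : set (tensor E F) :=
  [set t | forall n (O : set F), nbhs (0 : F) O ->
    exists2 w, W w & forall i, (i < n)%N -> O (tcoord i (t - w))].

(** A scalar may be moved between the factors of a term: one factor is made small at the expense of
    the other. *)
Lemma tensor_nbhs0_base_scaled U V k (x : nat -> E) (y : nat -> F) (c : nat -> R) :
  balanced_nbhs0_seq U -> balanced_nbhs0_seq V -> (forall l, c l != 0) ->
  (forall l, (l < k)%N -> U l (c l *: x l) /\ V l ((c l)^-1 *: y l)) ->
  tensor_nbhs0_base U V (\sum_(l < k) tens (x l) (y l)).
Proof.
move=> bU bV c0 xy.
have := @tensor_nbhs0_base_sum _ _ _ _ _ bU bV k _ _ xy.
by under eq_bigr => l _ do rewrite tens_scaleK//.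
Qed.

Lemma nbhs0_absorb_seq (G : topologicalLmodType R) (U : nat -> set G) (x : nat -> G) :
  balanced_nbhs0_seq U ->
  exists2 c : nat -> R, forall l, c l != 0 & forall l, U l (c l *: x l).
Proof.
move=> bU; have /boolp.choice[c cP] : forall l, exists c : R, c != 0 /\ U l (c *: x l).
  move=> l; have [c c0 cU] := nbhs0_absorbing (x l) (bU l).1.
  by exists c; split; [rewrite gt_eqF|apply: cU; rewrite gtr0_norm].
by exists c => l; [exact: (cP l).1|exact: (cP l).2].
Qed.

Lemma nbhs0_bigI (G : topologicalLmodType R) n (P : nat -> set G) :
  (forall i, nbhs (0 : G) (P i)) ->
  nbhs (0 : G) [set v | forall i, (i < n)%N -> P i v].
Proof.
move=> nP; elim: n => [|n IH]; first by apply: filterS filterT.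
apply: filterS (filterI IH (nP n)) => v [vn vP] i.
by rewrite ltnS leq_eqVlt => /predU1P[->//|]; exact: vn.
Qed.

(* For [t] of rank [r], approximate [t] by [w] in the base set and keep the first
   [r] terms of [w]. What remains has rank at most [2 r]. Cut it at the
   coordinate [N r]: the coordinates [i < N r] are small, so that they can be
   distributed over the terms [RN_e i (x) _], and what lies beyond [N r] is
   absorbed by [2 r] terms, since [U2 l], for [l < 2 r], contains all [x] whose
   first [N r] coordinates vanish. *)
Lemma tensor_nbhs0_base_closure U V :
  balanced_nbhs0_seq U -> balanced_nbhs0_seq V ->
  exists U' V', [/\ balanced_nbhs0_seq U', balanced_nbhs0_seq V' &
    coord_closure (tensor_nbhs0_base U' V') `<=` tensor_nbhs0_base U V].
Proof.
move=> bU bV; have [bU1 bV1] := (half_seq_balanced bU, half_seq_balanced bV).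
have [bU2 bV2] := (half_seq_balanced bU1, half_seq_balanced bV1).
set U1 := half_seq U in bU1 bU2; set V1 := half_seq V in bV1 bV2.
set U2 := half_seq U1 in bU2; set V2 := half_seq V1 in bV2.
have /boolp.choice[M MP] l : exists m, forall x : E,
    (forall i, (i < m)%N -> x i = 0) -> U2 l x by exact: RN_nbhs0_tail (bU2 l).1.
pose N K := (\sum_(l < K + K) M l)%N.
have Nh : {homo N : m n / (m <= n)%N}.
  move=> m n mn; rewrite /N (_ : n + n = m + m + (n - m + (n - m)))%N; last by lia.
  by rewrite [leqRHS]big_split_ord leq_addr.
have NP K l x : (l < K + K)%N -> (forall i, (i < N K)%N -> x i = 0) -> U2 l x.
  move=> lK xN; apply: MP => i iM; apply: xN; apply: leq_trans iM _.
  by rewrite /N (bigD1 (Ordinal lK)) //= leq_addr.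
(* [c] is fixed before [T]: for [v] in [T K] and [i < N K], the tensor of [RN_e R i] and [v] can
   then be written with factors in [U2 i] and [V2 i]. *)
have [c c0 cU] := nbhs0_absorb_seq (RN_e R) bU2.
have [T [bT TQ TD]] := @nbhs0_string R F
  (fun K => [set v | forall i, (i < N K)%N -> V2 i ((c i)^-1 *: v)])
  (fun K => nbhs0_bigI (N K) (fun i => nbhs0_scale (c i)^-1 (bV2 i).1)).
pose U' l := U1 l `&` RN_box (N l); pose V' l := V1 l `&` T l.+2.
have bU' : balanced_nbhs0_seq U'.
  by apply: balanced_nbhs0_seqI => //; exact: RN_box_seq.
have bV' : balanced_nbhs0_seq V'.
  by apply: (@balanced_nbhs0_seqI _ _ _ (fun l => T l.+2)).
exists U', V'; split=> // t tcl.
have [r [x0 [y0 tE]]] := tensor_rank_sum t.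
have [w Ww wt] := tcl (N r) (T r.+1) (bT r.+1).1.
have [x [y [xy wE]]] := @tensor_nbhs0_base_head N T r U' V' w bU' bV' bT TD Nh
  (fun l => @subIsetr _ _ _) (fun l => @subIsetr _ _ _) Ww.
set wr := \sum_(l < r) _ in wE.
rewrite -[t](subrK wr) addrC; apply: tensor_nbhs0_base_split => //.
  by apply: tensor_nbhs0_base_sum => // l _; have [[]] := xy l; move=> ? _ [].
have coordT i : (i < N r)%N -> T r (tcoord i (t - wr)).
  move=> iN; rewrite -(subrK w t) -addrA linearD /=.
  by apply: TD; [exact: wt|exact: wE].
have [xs [ys tw]] : exists xs ys, t - wr = \sum_(l < r + r) tens (xs l) (ys l).
  by rewrite tE; exact: sum_tensB.
rewrite tw (sum_tens_truncate (N r)) -tw.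
apply: tensor_nbhs0_base_split => //.
  apply: (@tensor_nbhs0_base_scaled _ _ _ (RN_e R) (fun i => tcoord i (t - wr)) c) => //.
  by move=> l lN; split; [exact: cU|exact: (TQ r _ (coordT l lN) l lN)].
(* Extension by 0 to a sequence indexed by [nat], as the base sets require. *)
pose ext (X : topologicalLmodType R) (f : 'I_(r + r) -> X) l :=
  if insub l is Some j then f j else 0.
pose xe l := ext E (fun j => RN_tail (N r) (xs j)) l; pose ye := ext F ys.
have [d d0 dV] := nbhs0_absorb_seq ye bV2.
have -> : \sum_l tens (RN_tail (N r) (xs l)) (ys l) = \sum_(l < r + r) tens (xe l) (ye l).
  by apply: eq_bigr => l _; rewrite /xe /ye /ext valK.
apply: (@tensor_nbhs0_base_scaled _ _ _ xe ye (fun l => (d l)^-1)) => //.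
  by move=> l; rewrite invr_neq0.
move=> l lr; split; last by rewrite invrK; exact: dV.
by apply: (NP r) => // i iN; rewrite RN_scaleE /xe /ext insubT /RN_tail iN mulr0.
Qed.

End Closure.

(** * Lower semicontinuity of the rank of sequences in F *)

Lemma rV_sphere_compact (R : realType) n : compact [set c : 'rV[R]_n | `|c| = 1].
Proof.
apply: bounded_closed_compact.
  by exists 1; split=> // M M1 c /= ->; exact: ltW.
apply: (@closed_comp _ _ (fun c : 'rV[R]_n => `|c|) [set 1]).
  by move=> c _; exact: norm_continuous.
exact: closed_eq.
Qed.

Lemma mulmx_tall_ker (K : fieldType) k (X : 'M[K]_(k.+1, k)) :
  exists2 c : 'rV_k.+1, c != 0 & c *m X = 0.
Proof.
have : kermx X != 0.
  by rewrite -mxrank_eq0 mxrank_ker subn_eq0 -ltnNge ltnS rank_leq_col.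
by move=> /rowV0Pn[c /sub_kermxP cX c0]; exists c.
Qed.

Section RankSemicontinuity.
Context (R : realType) (F : topologicalLmodType R).

Definition lin_indep k (v : 'I_k -> F) :=
  forall c : 'I_k -> R, \sum_j c j *: v j = 0 -> forall j, c j = 0.

Lemma continuous_sum (X : topologicalType) k (g : 'I_k -> X -> F) :
  (forall j, continuous (g j)) -> continuous (fun x => \sum_j g j x).
Proof.
elim: k g => [|k IH] g cg x.
  by under eq_fun => y do rewrite big_ord0; exact: cvg_cst.
under eq_fun => y do rewrite big_ord_recr.
apply: (@continuous_comp _ _ _ (fun y => (\sum_(j < k) g (widen_ord (leqnSn k) j) y, g ord_max y))
  (fun z : F * F => z.1 + z.2)); last exact: add_continuous.
by apply: cvg_pair; [exact: (IH (fun j => g (widen_ord (leqnSn k) j)))|exact: cg].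
Qed.

Lemma lincomb_continuous k (v : 'I_k -> F) :
  continuous (fun c : 'rV[R]_k => \sum_j c 0 j *: v j).
Proof.
apply: continuous_sum => j c.
apply: (@continuous_comp _ _ _ (fun c : 'rV[R]_k => (c 0 j : R^o, v j))
  (fun z : R^o * F => z.1 *: z.2)); last exact: scale_continuous.
have Fc := nbhs_filter c; apply: (@cvg_pair _ _ _ _ (nbhs (c 0 j : R^o))) => //.
  exact: (@coord_continuous R 1 k 0 j c).
exact: cvg_cst.
Qed.

(** Independence keeps 0 out of the compact, hence closed, image [C] of the unit sphere under
    [c |-> \sum_j c j *: v j]. If the [v j] had the stated form, some [c] of norm 1 would annihilate
    the part of rank at most [k], leaving [\sum_j c j *: u j] in [C]; but for small [u j] this sum
    lies outside of [C]. *)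
Lemma lin_indep_perturb k (v : 'I_k.+1 -> F) : hausdorff_space F -> lin_indep v ->
  exists2 O : set F, nbhs 0 O &
    forall (u : 'I_k.+1 -> F) (x : 'I_k.+1 -> 'I_k -> R) (y : 'I_k -> F),
      (forall j, O (u j)) -> ~ forall j, v j = \sum_l x j l *: y l + u j.
Proof.
move=> hF vfree.
pose f (c : 'rV[R]_k.+1) := \sum_j c 0 j *: v j.
pose C := f @` [set c | `|c| = 1].
have cC : closed C.
  apply: compact_closed => //; apply: continuous_compact.
    apply: continuous_subspaceT; exact: lincomb_continuous.
  exact: rV_sphere_compact.
have nC : nbhs (0 : F) (~` C).
  apply: open_nbhs_nbhs; split; first exact: closed_openC.
  move=> [c c1 /vfree c0]; have /eqP := c1; apply/negP.
  by rewrite (_ : c = 0) ?normr0 1?eq_sym ?oner_eq0//; apply/rowP => j; rewrite c0 mxE.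
have [T [bT TC TD]] := @nbhs0_string R F (fun=> ~` C) (fun=> nC).
exists (T k.+2); first exact: (bT _).1.
move=> u x y uT vE.
have [c' c'0 cX] := mulmx_tall_ker (\matrix_(j, l) x j l : 'M[R]_(k.+1, k)).
pose c := `|c'|^-1 *: c'.
have c1 : `|c| = 1 by rewrite normrZ normfV normr_id mulVf// normr_eq0.
have {c'0} cX0 : c *m (\matrix_(j, l) x j l) = 0 by rewrite -scalemxAl cX scaler0.
apply: (TC 0%N (f c)); last by exists c.
have -> : f c = \sum_j c 0 j *: u j.
  rewrite /f; under eq_bigr => j _ do rewrite vE scalerDr scaler_sumr.
  rewrite big_split /= exchange_big /= big1 ?add0r// => l _.
  under eq_bigr => j _ do rewrite scalerA.
  rewrite -scaler_suml (_ : \sum_j _ = 0) ?scale0r//.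
  have := congr1 (fun M : 'rV_k => M 0 l) cX0; rewrite mxE [RHS]mxE => cXl.
  by apply: etrans cXl; apply: eq_bigr => j _; congr (_ * _); rewrite mxE.
pose ext j := if insub j is Some j' then c 0 j' *: u j' else 0 : F.
rewrite (_ : \sum_j _ = \sum_(j < k.+1) ext j); last first.
  by apply: eq_bigr => j _; rewrite /ext valK.
apply: (@string_sum _ T (fun n => balanced0 n bT) TD k.+1 0%N ext) => j jk.
rewrite /ext insubT; apply: (bT _).2; last first.
  by apply: (string_decr (fun n => balanced0 n bT) TD) (uT _); lia.
rewrite -c1 [leRHS]/Num.norm /= mx_normrE.
exact: (@le_bigmax _ _ _ 0 (fun ij => `|c ij.1 ij.2|) (0, Ordinal jk)).
Qed.

(** Greedy choice: the [k] terms already chosen do not span all of [v], as otherwise [v] would have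
    finite rank. *)
Lemma lin_indep_extract (v : nat -> F) :
  ~ (exists k (x : 'I_k -> RN R) (y : 'I_k -> F), forall i, v i = \sum_l x l i *: y l) ->
  forall k, exists idx : 'I_k -> nat, lin_indep (fun j => v (idx j)).
Proof.
move=> vinf; elim=> [|k [idx idxP]]; first by exists (fun=> 0%N) => c _ [].
have [i iP] : exists i, forall c : 'I_k -> R, v i <> \sum_j c j *: v (idx j).
  apply: contrapT => /forallNP vI; apply: vinf.
  have /boolp.choice[c cP] : forall i, exists c : 'I_k -> R, v i = \sum_j c j *: v (idx j).
    by move=> i; have /existsNP[c /contrapT] := vI i; exists c.
  by exists k, (fun l i => c i l), (v \o idx).
exists (fun j => if unlift ord0 j is Some j' then idx j' else i) => c.
rewrite big_ord_recl unlift_none.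
under eq_bigr => j _ do rewrite liftK.
move=> cE; have c0 : c ord0 = 0.
  have [//|c0] := eqVneq (c ord0) 0; case: (iP (fun j => - (c ord0)^-1 * c (fintype.lift ord0 j))).
  under eq_bigr => j _ do rewrite -scalerA.
  move/eqP: cE; rewrite -scaler_sumr addr_eq0 => /eqP cE.
  by rewrite scaleNr -scalerN -cE scalerK.
move=> j; case: (unliftP ord0 j) => [j' ->|->//].
apply: (idxP (fun j => c (fintype.lift ord0 j))).
by move: cE; rewrite c0 scale0r add0r.
Qed.

(** There are [k.+1] independent terms among finitely many indices, and no small perturbation of
    these terms has rank at most [k]. *)
Lemma infinite_rank_perturb (v : nat -> F) k : hausdorff_space F ->
  ~ (exists k (x : 'I_k -> RN R) (y : 'I_k -> F), forall i, v i = \sum_l x l i *: y l) ->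
  exists (n : nat) (O : set F), nbhs (0 : F) O /\
    forall (u : nat -> F) (x : 'I_k -> RN R) (y : 'I_k -> F),
      (forall i, (i < n)%N -> O (u i)) ->
      ~ forall i, (i < n)%N -> v i = \sum_l x l i *: y l + u i.
Proof.
move=> hF /lin_indep_extract/(_ k.+1)[idx /(lin_indep_perturb hF)[O nO OP]].
have idxn j : (idx j < (\max_j idx j).+1)%N by rewrite ltnS leq_bigmax.
exists (\max_j idx j).+1, O; split=> // u x y uO vE.
apply: (OP (u \o idx) (fun j l => x l (idx j)) y) => j; first exact: uO.
exact: vE.
Qed.

End RankSemicontinuity.

(** * Completeness of E (x) F for complete Hausdorff F *)

Section Completeness.
Context (R : realType) (F : topologicalLmodType R).
Local Notation E := (RN R).

Lemma tensor_nbhs0_base_nbhs (G H : topologicalLmodType R) (U : nat -> set G) (V : nat -> set H) :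
  balanced_nbhs0_seq U -> balanced_nbhs0_seq V ->
  nbhs (0 : tensor G H) (tensor_nbhs0_base U V).
Proof. by move=> bU bV; exists U, V; split=> // w; rewrite add0r. Qed.

Lemma linear_cauchy_image (G H : topologicalLmodType R) (f : {linear G -> H})
    (Phi : set_system G) :
  Filter Phi -> continuous f -> cauchy_filter Phi -> cauchy_filter (f @ Phi).
Proof.
move=> FPhi cf cPhi U nU; have := cf 0 U; rewrite linear0 => /(_ nU) /cPhi[A PA AA].
exists (f @` A); first by apply: (@filterS _ Phi _ A) PA => x Ax; exists x.
by move=> _ _ [x Ax <-] [y Ay <-]; rewrite -linearB; exact: AA.
Qed.

Section CauchyLimit.
Variables (Phi : set_system (tensor E F)) (v : nat -> F).
Hypotheses (PPhi : ProperFilter Phi) (cPhi : cauchy_filter Phi).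
Hypothesis vP : forall i, tcoord i @ Phi --> v i.

(** Pass to the limit in [b] in the relation that [a - b] lies in [W]. The result is stated by
    coordinates because [v] is not yet known to come from a tensor. *)
Lemma cauchy_coord_near W : nbhs (0 : tensor E F) W ->
  exists2 A, Phi A & forall a, A a -> forall n (O : set F), nbhs (0 : F) O ->
    exists2 w, W w & forall i, (i < n)%N -> O (tcoord i a - v i - tcoord i w).
Proof.
move=> /cPhi[A PA AA]; exists A => // a Aa n O nO.
have nO' i : Phi [set b | O (tcoord i b - v i)].
  have := @vP i [set z | O (z - v i)]; apply; apply/nbhs_translate.
  by apply: filterS nO => z; rewrite /= addrC addKr.
have nOn : Phi [set b | forall i, (i < n)%N -> O (tcoord i b - v i)].
  elim: n => [|n IH]; first by apply: filterS filterT.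
  apply: filterS (filterI IH (nO' n)) => b [bn bO] i.
  by rewrite ltnS leq_eqVlt => /predU1P[->//|]; exact: bn.
have [b [Ab bO]] := filter_ex (filterI PA nOn).
exists (a - b); first exact: AA.
by move=> i /bO ?; rewrite linearB opprB addrC addrA subrK.
Qed.

(* Take [a], of rank [r], in a member of the filter that is small of order
   [tensor_nbhs0_base U V], with [U l = RN_box (N l)] and [V l = T l.+2]. On the
   coordinates [i < N r], [v] is a sequence of rank at most [2 r] up to a
   perturbation in [T r]. If [v] had infinite rank, [N] and [T] could be chosen to
   make this impossible for all [r]. *)
Lemma cauchy_limit_finite_rank : hausdorff_space F ->
  exists t, forall i, tcoord i t = v i.
Proof.
move=> hF; have [[k [x [y vE]]]|vinf] := pselect
    (exists k (x : 'I_k -> E) (y : 'I_k -> F), forall i, v i = \sum_l x l i *: y l).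
  by exists (\sum_l tens (x l) (y l)) => i; rewrite tcoord_sum.
exfalso; have /boolp.choice[n nP] r := infinite_rank_perturb (r + r) hF vinf.
have {nP} /boolp.choice[O OP] := nP.
(* Partial sums make [N] monotone while still bounding [n]. *)
pose N K := (\sum_(l < K.+1) n l)%N.
have Nh : {homo N : p q / (p <= q)%N}.
  move=> p q pq; rewrite /N (_ : q.+1 = p.+1 + (q - p))%N; last by lia.
  by rewrite [leqRHS]big_split_ord leq_addr.
have nN r : (n r <= N r)%N by rewrite /N big_ord_recr leq_addl.
have [T [bT TO TD]] := @nbhs0_string R F O (fun r => (OP r).1).
have bU := RN_box_seq R N; have bV : balanced_nbhs0_seq (fun l => T l.+2) by move=> l.
have [A PA AP] := cauchy_coord_near (tensor_nbhs0_base_nbhs bU bV).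
have [a Aa] := filter_ex PA.
have [r [x0 [y0 aE]]] := tensor_rank_sum a.
have [w Ww aw] := AP _ Aa (N r) (T r.+1) (bT r.+1).1.
have [x [y [_ wE]]] := @tensor_nbhs0_base_head R F N T r _ _ w bU bV bT TD Nh
  (fun l => @subset_refl _ _) (fun l => @subset_refl _ _) Ww.
set wr := \sum_(l < r) _ in wE.
have [xs [ys awr]] : exists xs ys, a - wr = \sum_(l < r + r) tens (xs l) (ys l).
  by rewrite aE; exact: sum_tensB.
apply: ((OP r).2 (fun i => v i - tcoord i (a - wr)) xs ys) => [i ir|i _].
  have iN : (i < N r)%N := leq_trans ir (nN r).
  apply: TO; rewrite -opprB -scaleN1r; apply: (bT r).2; first by rewrite normrN1.
  rewrite -(subrK w a) -addrA linearD linearB /= addrAC [X in X + _]addrAC.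
  by apply: TD; [exact: aw|exact: wE].
by rewrite -tcoord_sum -awr addrC subrK.
Qed.

Lemma cauchy_limit_cvg t : (forall i, tcoord i t = v i) -> Phi --> t.
Proof.
move=> tv A [U [V [bU bV UVA]]].
have [U' [V' [bU' bV' cl]]] := tensor_nbhs0_base_closure bU bV.
have [B PB BP] := cauchy_coord_near (tensor_nbhs0_base_nbhs bU' bV').
apply: filterS PB => b Bb; rewrite -[b](subrK t) addrC; apply/UVA/cl => n O nO.
have [w Ww wO] := BP _ Bb n O nO; exists w => // i /wO.
by rewrite -tv !linearB.
Qed.

End CauchyLimit.

Lemma tensor_RN_complete :
  hausdorff_space F -> complete_group F -> complete_group (tensor E F).
Proof.
move=> hF cF Phi PPhi cPhi.
have /boolp.choice[v vP] i : exists vi : F, tcoord i @ Phi --> vi.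
  by apply: cF; apply: linear_cauchy_image cPhi; exact: tcoord_continuous.
have [t tv] := cauchy_limit_finite_rank PPhi cPhi vP hF.
by exists t; exact: (cauchy_limit_cvg PPhi cPhi vP).
Qed.

End Completeness.

(** * Exchange of the factors, which carries the results to F (x) E *)

Section Swap.
Context (R : realType) (E F : topologicalLmodType R).

Let swap_bilin (G H : topologicalLmodType R) :
  bilinear_for *:%R *:%R (fun (x : G) (y : H) => tens y x).
Proof.
by split=> [y a x x'|x a y y'] /=; [exact: linearPr|exact: linearPl].
Qed.

Definition tensor_swap : tensor E F -> tensor F E :=
  tensor_lift (fun x y => tens y x).

Lemma tensor_swap_is_linear : linear tensor_swap.
Proof. exact: tensor_lift_linear (swap_bilin E F). Qed.

HB.instance Definition _ := GRing.isLinear.Build R (tensor E F) (tensor F E)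
  *:%R tensor_swap tensor_swap_is_linear.

Lemma tensor_swap_tens x y : tensor_swap (tens x y) = tens y x.
Proof. exact: tensor_liftE (swap_bilin E F) x y. Qed.

Lemma tensor_swap_continuous : continuous tensor_swap.
Proof.
apply: tensor_lift_continuous (swap_bilin E F) _ => -[x y] A.
move=> /(@tens_continuous R F E (y, x))[[P Q] [/= nP nQ] PQ].
by exists (Q, P) => // -[x' y'] [/= Qx Py]; exact: (PQ (y', x')).
Qed.

End Swap.

Section SwapTheory.
Context (R : realType) (E F : topologicalLmodType R).

Lemma tensor_swapK : cancel (@tensor_swap R E F) (@tensor_swap R F E).
Proof.
move=> t; have [k [x [y ->]]] := alg_tensor_sum t.
rewrite -[\sum_(l < k) _]/(\sum_(l < k) tens (x l) (y l)) !linear_sum.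
by apply: eq_bigr => l _; rewrite /= !tensor_swap_tens.
Qed.

Lemma tensor_swap_hausdorff :
  hausdorff_space (tensor F E) -> hausdorff_space (tensor E F).
Proof.
move=> h s t st; apply: (can_inj tensor_swapK); apply: h => A B nA nB.
have [u [Au Bu]] := st _ _ (tensor_swap_continuous nA) (tensor_swap_continuous nB).
by exists (tensor_swap u).
Qed.

End SwapTheory.

Lemma tensor_swap_complete (R : realType) (E F : topologicalLmodType R) :
  complete_group (tensor F E) -> complete_group (tensor E F).
Proof.
move=> cFE Phi PPhi cPhi.
have [t Pt] := cFE (@tensor_swap R E F @ Phi) (fmap_proper_filter _ PPhi)
  (linear_cauchy_image _ (@tensor_swap_continuous R E F) cPhi).
exists (@tensor_swap R F E t) => A nA.
have := Pt _ (@tensor_swap_continuous R F E t A nA).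
by apply: (@filterS _ Phi) => u /=; rewrite tensor_swapK.
Qed.

(** * Topological abelian groups and additive maps *)

Section GroupTheory.
Context (G : topologicalZmodType).

Lemma group_nbhs_translate (x : G) U : nbhs x U -> nbhs (0 : G) [set y | U (x + y)].
Proof.
move=> nU; have := @add_continuous G (x, 0) U; rewrite /= addr0 => /(_ nU).
move=> [[A B] [/= xA B0] AB]; apply: filterS B0 => y By.
by apply: (AB (x, y)); split=> //; exact: nbhs_singleton.
Qed.

Lemma group_nbhs0_string (Q : set G) : nbhs (0 : G) Q ->
  exists T : nat -> set G, [/\ forall n, nbhs (0 : G) (T n), T 0%N = Q &
    forall n x y, T n.+1 x -> T n.+1 y -> T n (x + y)].
Proof.
move=> nQ.
have /boolp.choice[h hP] : forall U : set G, exists V : set G,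
    nbhs (0 : G) U -> nbhs (0 : G) V /\ forall x y, V x -> V y -> U (x + y).
  move=> U; have [nU|nU] := pselect (nbhs (0 : G) U); last by exists setT.
  have := @add_continuous G (0, 0) U; rewrite /= addr0 => /(_ nU).
  move=> [[A B] [/= A0 B0] AB]; exists (A `&` B) => _; split; first exact: filterI.
  by move=> x y [Ax _] [_ By]; exact: (AB (x, y)).
pose T n := iter n h Q; have nT n : nbhs (0 : G) (T n) by elim: n => // n /hP[].
by exists T; split=> // n; have [_] := hP _ (nT n).
Qed.

(** Rationals near [a] show that [phi a] and 0 have no disjoint neighbourhoods. *)
Lemma continuous_eq0_rat (R : realType) (phi : R -> G) : hausdorff_space G ->
  continuous (phi : R^o -> G) -> (forall q, phi (ratr q) = 0) -> forall a, phi a = 0.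
Proof.
move=> hG cphi phi0 a; apply: hG => A B /(cphi a) nA nB.
have /nbhs_ballP[e /= e0 eA] := nA.
have [q] : exists q, ratr q \in `](a - e), (a + e)[.
  by apply: rat_in_itvoo; rewrite ltrBlDr -addrA ltrDl addr_gt0.
rewrite in_itv /= => /andP[aq qa]; exists 0; split; last exact: nbhs_singleton nB.
by rewrite -(phi0 q); apply: eA; rewrite /ball /= distrC ltr_distl aq.
Qed.

End GroupTheory.

Section ZmodMorphism.
Context (U V : zmodType) (g : U -> V).
Hypothesis gB : zmod_morphism g.
Let h : {additive U -> V} := HB.pack g (GRing.isZmodMorphism.Build _ _ _ gB).

Lemma zmod_morphism0 : g 0 = 0.
Proof. exact: (raddf0 h). Qed.

Lemma zmod_morphismD : {morph g : x y / x + y}.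
Proof. exact: (raddfD h). Qed.

Lemma zmod_morphismMz n : {morph g : x / x *~ n}.
Proof. exact: (raddfMz h). Qed.

Lemma zmod_morphism_sum k (s : 'I_k -> U) : g (\sum_l s l) = \sum_l g (s l).
Proof. exact: (raddf_sum h). Qed.

End ZmodMorphism.

(** * The universal property among Hausdorff abelian groups *)

Section GroupUniversal.
Context (R : realType) (E F : topologicalLmodType R).
Context (G : topologicalZmodType) (f : E -> F -> G).
Hypotheses (bf : biadditive f) (cf : continuous (fun p : E * F => f p.1 p.2)).

(** Both sides are continuous in [a]; for [a = n / d] both are the multiple by [n d] of the value of
    [f] at [x / d] and [y / d]. *)
Lemma biadditive_balanced a x y : hausdorff_space G -> f (a *: x) y = f x (a *: y).
Proof.
move=> hG; apply/eqP; rewrite -subr_eq0; apply/eqP; move: a.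
apply: (@continuous_eq0_rat G R (fun a => f (a *: x) y - f x (a *: y))) => //.
  have cx (X : topologicalLmodType R) (z : X) : continuous (fun a : R^o => a *: z).
    move=> a; have Fa := nbhs_filter a.
    apply: (@continuous_comp _ _ _ (fun a : R^o => (a, z)) (fun p : R^o * X => p.1 *: p.2));
      last exact: scale_continuous.
    by apply: (@cvg_pair _ _ _ _ (nbhs (a : R^o))); [exact: cvg_id|exact: cvg_cst].
  move=> a; apply: (@continuous_comp _ _ _
    (fun a : R^o => (f (a *: x) y, f x (a *: y))) (fun p : G * G => p.1 - p.2));
    last exact: sub_continuous.
  apply: cvg_pair.
    apply: (@continuous_comp _ _ _ (fun a : R^o => (a *: x, y)) (fun p : E * F => f p.1 p.2));
      last exact: cf.
    by apply: cvg_pair; [exact: cx|exact: cvg_cst].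
  apply: (@continuous_comp _ _ _ (fun a : R^o => (x, a *: y)) (fun p : E * F => f p.1 p.2));
    last exact: cf.
  by apply: cvg_pair; [exact: cvg_cst|exact: cx].
move=> q; have d0 : (denq q)%:~R != 0 :> R by rewrite intr_eq0 denq_neq0.
have divd (X : lmodType R) (z : X) : z = ((denq q)%:~R^-1 *: z) *~ denq q.
  by rewrite -scaler_int scalerA divff// scale1r.
have muln (X : lmodType R) (z : X) :
    (ratr q : R) *: z = ((denq q)%:~R^-1 *: z) *~ numq q.
  by rewrite -scaler_int scalerA.
rewrite !muln {1}(divd F y) {2}(divd E x).
rewrite (zmod_morphismMz (bf.1 _)) (zmod_morphismMz (bf.2 _)).
by rewrite (zmod_morphismMz (bf.1 _)) (zmod_morphismMz (bf.2 _)) mulrzAC subrr.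
Qed.

(** [G] has no real scalars, so the coefficients are put into the first argument of [f]. *)
Definition freeg_glift (u : {freeg (E * F)%type / R}) : G :=
  \sum_(p <- dom u) f (coeff p u *: p.1) p.2.

Let f0l y : f 0 y = 0. Proof. exact: zmod_morphism0 (bf.1 y). Qed.

Lemma freeg_gliftE u (s : seq (E * F)) : uniq s -> {subset dom u <= s} ->
  freeg_glift u = \sum_(p <- s) f (coeff p u *: p.1) p.2.
Proof.
move=> us us'; rewrite [RHS](bigID [in dom u]) /= [X in _ + X]big1 ?addr0; last first.
  by move=> p /coeff_outdom ->; rewrite scale0r f0l.
rewrite -big_filter; apply: perm_big; apply: uniq_perm => //; first exact: uniq_dom.
  exact: filter_uniq.
move=> p; rewrite mem_filter; case: (boolP (p \in dom u)) => // /us' ->.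
by [].
Qed.

Lemma freeg_gliftB : zmod_morphism freeg_glift.
Proof.
move=> u v; pose s := undup (dom (u - v) ++ dom u ++ dom v).
have us : uniq s := undup_uniq _.
rewrite !(@freeg_gliftE _ s)//; try by move=> p; rewrite mem_undup !mem_cat => ->; rewrite ?orbT.
rewrite -sumrB; apply: eq_bigr => p _.
by rewrite coeffB scalerBl (bf.1 _).
Qed.

Lemma freeg_gliftU a x y : freeg_glift (a *: <<(x, y)>>) = f (a *: x) y.
Proof.
rewrite (@freeg_gliftE _ [:: (x, y)])//.
  by rewrite big_seq1 coeffZ coeffU eqxx !mulr1.
by move=> p /domZ_subset; rewrite domU1.
Qed.

Hypothesis hG : hausdorff_space G.

(** As [freeg_glift] is only additive, the factor [a] is carried along to make the induction pass
    through [tensor_nullDZ]. The relation for the second variable rests on [biadditive_balanced]. *)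
Lemma freeg_glift_null u a : tensor_null u -> freeg_glift (a *: u) = 0.
Proof.
have gD := zmod_morphismD freeg_gliftB; have gB := freeg_gliftB.
move=> nu; elim: nu a => [a|b v w _ IHv _ IHw a|b x x' y a|b x y y' a].
- by rewrite scaler0; exact: zmod_morphism0 freeg_gliftB.
- by rewrite scalerDr scalerA gD IHv IHw addr0.
- rewrite scalerBr gB scalerDr gD scalerA !freeg_gliftU scalerDr scalerA.
  by rewrite (zmod_morphismD (bf.1 y)) subrr.
rewrite scalerBr gB scalerDr gD scalerA !freeg_gliftU (zmod_morphismD (bf.2 _)).
by rewrite -biadditive_balanced// scalerA [b * a]mulrC subrr.
Qed.

Definition tensor_glift (t : tensor E F) : G :=
  freeg_glift (repr (t : Quotient.quot (@tensor_ker R E F))).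

Lemma tensor_glift_proj u : tensor_glift (alg_tensor_proj u) = freeg_glift u.
Proof.
apply/eqP; rewrite -subr_eq0 -freeg_gliftB -[_ - u]scale1r freeg_glift_null//.
by apply/tensor_kerP/alg_tensor_projP; rewrite /alg_tensor_proj reprK.
Qed.

Lemma tensor_gliftB : zmod_morphism tensor_glift.
Proof.
move=> t t'; have [u ->] := alg_tensor_proj_ex t; have [v ->] := alg_tensor_proj_ex t'.
rewrite -[_ - _](alg_tensor_projB u v) !tensor_glift_proj; exact: freeg_gliftB.
Qed.

Lemma tensor_glift_tens x y : tensor_glift (tens x y) = f x y.
Proof. by rewrite [LHS]tensor_glift_proj -[<<_>>]scale1r freeg_gliftU scale1r. Qed.

(** Choose the [n]-th pair of neighbourhoods so that [f] maps it into [S n.+1], for a string [S]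
    starting at the translated [A]; the sums then stay in [S 0]. *)
Lemma tensor_additive_continuous (g : tensor E F -> G) : zmod_morphism g ->
  (forall x y, g (tens x y) = f x y) -> continuous g.
Proof.
move=> gB gE t A /group_nbhs_translate/group_nbhs0_string[S [nS SA SD]].
have /boolp.choice[W WP] : forall n, exists W : set E * set F,
    [/\ nbhs (0 : E) W.1 /\ balanced W.1, nbhs (0 : F) W.2 /\ balanced W.2 &
      forall x y, W.1 x -> W.2 y -> S n.+1 (f x y)].
  move=> n; have := @cf (0, 0) (S n.+1).
  rewrite [f (0, 0).1 _]f0l => /(_ (nS n.+1)) [[P Q] [/= nP nQ] PQ].
  have [P' bP PP] := nbhs0_balanced nP; have [Q' bQ QQ] := nbhs0_balanced nQ.
  by exists (P', Q'); split=> // x y /PP Px /QQ Qy; exact: (PQ (x, y)).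
exists (fun n => (W n).1), (fun n => (W n).2).
split; [by move=> k; case: (WP k)|by move=> k; case: (WP k)|].
move=> _ [k [x [y [xy ->]]]] /=.
rewrite (zmod_morphismD gB) (zmod_morphism_sum gB).
under eq_bigr => l _ do rewrite gE.
suff : S 0%N (\sum_(l < k.+1) f (x l) (y l)) by rewrite SA.
apply: (@string_sum _ S (fun n => nbhs_singleton (nS n)) SD k.+1 0%N
  (fun l => f (x l) (y l))) => l /xy[Wx Wy].
by have [_ _] := WP l; exact.
Qed.

End GroupUniversal.

Lemma tensor_is_group_tensor (R : realType) (E F : topologicalLmodType R) :
  hausdorff_space E -> hausdorff_space F -> hausdorff_space (tensor E F) ->
  is_group_tensor hausdorff_group (@tens R E F).
Proof.
move=> hE hF hEF; split=> //; split.
- by split=> [y u v|x u v]; [exact: linearBl|exact: linearBr].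
- exact: tens_continuous.
move=> G f hG bf cf; exists (tensor_glift f); split.
  split; [exact: tensor_gliftB| |exact: tensor_glift_tens].
  apply: (tensor_additive_continuous bf cf); [exact: tensor_gliftB|].
  exact: tensor_glift_tens.
move=> g [gB _ gE]; apply/funext => t.
have [k [x [y ->]]] := alg_tensor_sum t.
rewrite (zmod_morphism_sum gB) (zmod_morphism_sum (tensor_gliftB bf cf hG)).
apply: eq_bigr => l _; rewrite -[alg_tens _ _]/(tens _ _) gE.
exact: tensor_glift_tens.
Qed.

(** * Failure of associativity *)

Section NonAssociativity.
Context (R : realType).
Local Notation E := (RN R).
Local Notation EE := (tensor E E).

(** The left side is the entry [(h, i)] of the sum of the [e_j (x) e_j]. *)
Lemma RN_e_diag (h i : nat) p : (h < p)%N ->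
  \sum_(j < p) RN_e R j h * RN_e R j i = (h == i)%:R :> R.
Proof.
move=> hp; rewrite (bigD1 (Ordinal hp))//= big1 ?addr0 => [|j].
  by rewrite /RN_e eqxx mul1r eq_sym.
by rewrite -val_eqE /RN_e /= eq_sym => /negPf ->; rewrite mul0r.
Qed.

(** Paired with [RN_box l.+1], a term [l >= p] contributes at most [2 ^- l.+1] to each entry with
    indices at most [p], so all these terms together contribute at most 1. *)
Definition entry_box (l : nat) : set EE :=
  [set w | forall i, (i < l.+1)%N -> forall j, (j < l.+1)%N ->
    `|(tcoord i w : E) j| <= 2 ^- l.+1].

Lemma entry_box_seq : balanced_nbhs0_seq entry_box.
Proof.
move=> l; split; last first.
  move=> a w a1 wl i il j jl; rewrite linearZ /= normrM.
  by rewrite (le_trans _ (wl i il j jl))// ler_piMl.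
apply: nbhs0_bigI => i; apply: (@nbhs0_bigI R EE l.+1
  (fun j => [set w : EE | `|(tcoord i w : E) j| <= 2 ^- l.+1])) => j.
have := @tcoord_continuous R E i 0 [set x : E | `|x j| <= 2 ^- l.+1].
apply; rewrite linear0; apply: (@RN_coord_nbhs R j 0 [set z : R^o | `|z| <= 2 ^- l.+1]).
apply/nbhs_ballP; exists (2 ^- l.+1) => /=; first by rewrite invr_gt0 exprn_gt0.
by move=> z; rewrite /ball /= sub0r normrN; exact: ltW.
Qed.

Lemma entry_sum h i j k (x : 'I_k -> E) (w : 'I_k -> EE) :
  (tcoord i (tcoord h (\sum_l tens (x l) (w l)) : EE) : E) j =
  \sum_l x l h * (tcoord i (w l) : E) j.
Proof.
rewrite tcoord_sum linear_sum RN_sumE; apply: eq_bigr => l _.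
by rewrite /= linearZ.
Qed.

(* [Theta] sends [c (sum_(i <= p) e_i (x) e_i) (x) e_p] to
   [c sum_(i <= p) e_i (x) (e_i (x) e_p)]. Its entries [(h, i, p)], [h, i <= p],
   form the matrix [c%:M] of order [p.+1]; for an element of the base set of the
   sequences [RN_box l.+1] and [entry_box l], they form a matrix of rank at most
   [p] (from the terms [l < p]) up to entries bounded by [1]. This is impossible
   for [c = p + 2], but [p] and [c] can be chosen so that the tensor lies in a
   given neighbourhood of [0], as such a neighbourhood contains [a (x) e_p] for
   some [p] and all [a]. *)
Lemma tensor_RN_not_assoc (Theta : tensor EE E -> tensor E EE) :
  zmod_morphism Theta -> continuous Theta ->
  (forall x y z : E, Theta (tens (tens x y : EE) z) = tens x (tens y z : EE)) ->
  False.
Proof.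
move=> ThB cTh ThE.
have bU := RN_box_seq R S; have bV := entry_box_seq.
set W := tensor_nbhs0_base (fun l => RN_box l.+1) entry_box.
have nW : nbhs (0 : tensor E EE) W by exact: tensor_nbhs0_base_nbhs.
have := @tens_continuous R EE E (0, 0) [set t | W (Theta t)].
rewrite /= linear0l => nP; have {nP} := nP (cTh 0 W _).
rewrite (zmod_morphism0 ThB) => /(_ nW) [[P Q] [/= nP nQ] PQ].
have [p pQ] := RN_nbhs0_tail nQ.
pose a : EE := \sum_(i < p.+1) tens (RN_e R i) (RN_e R i).
have [e e0 eP] := nbhs0_absorbing a nP.
(* The factor [e] brings [a] into [P]; its inverse is absorbed by [RN_e R p], all of whose multiples
   lie in [Q]. *)
have /PQ /= : (P `*` Q) (e *: a, (e^-1 * p.+2%:R) *: RN_e R p).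
  split=> /=; first by apply: eP; rewrite gtr0_norm.
  by apply: pQ => i ip; rewrite RN_scaleE /RN_e ltn_eqF// mulr0.
have -> : tens (e *: a) ((e^-1 * p.+2%:R) *: RN_e R p) =
    \sum_(i < p.+1) tens (tens (RN_e R i) (RN_e R i) : EE) (p.+2%:R *: RN_e R p).
  by rewrite -scalerA tens_scaleK ?gt_eqF// linear_sumlz.
rewrite (zmod_morphism_sum ThB); under eq_bigr => i _ do rewrite ThE.
move=> /(tensor_nbhs0_base_widen bU bV)[k kP].
have [x [w [xw tE]]] := kP _ (leq_addl p k).
pose B (h i : nat) : R := \sum_(l < k) x (p + l)%N h * (tcoord i (w (p + l)%N) : E) p.
have entryE (h i : 'I_p.+1) : p.+2%:R * (h == i)%:R =
    \sum_(l < p) x l h * (tcoord i (w l) : E) p + B h i.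
  transitivity ((tcoord i (tcoord h (\sum_(l < p + k) tens (x l) (w l)) : EE) : E) p);
    last by rewrite entry_sum big_split_ord.
  rewrite -tE entry_sum -(RN_e_diag i (ltn_ord h)) mulr_sumr.
  apply: eq_bigr => j _; rewrite tcoord_tens !RN_scaleE.
  have -> : RN_e R p p = 1 by rewrite /RN_e eqxx.
  by rewrite mulr1 [RHS]mulrA mulrC.
have B1 (h i : 'I_p.+1) : `|B h i| <= 1.
  (* These intervals form a string in the reals; it bounds the sum of the terms from [p] on. *)
  pose T n := [set r : R | `|r| <= 2 ^- n].
  have T0 n : T n 0 by rewrite /T /= normr0 invr_ge0 exprn_ge0.
  have TD n r s : T n.+1 r -> T n.+1 s -> T n (r + s).
    rewrite /T /= => rn sn; rewrite (le_trans (ler_normD _ _))//.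
    rewrite (le_trans (lerD rn sn))// exprS invfM -mulrDl.
    by rewrite -[2^-1]mul1r -splitr mul1r.
  rewrite (_ : 1 = 2 ^- 0); last by rewrite expr0 invr1.
  apply: (string_decr T0 TD (leq0n p)).
  apply: (string_sum T0 TD (s := fun l => x (p + l)%N h * (tcoord i (w (p + l)%N) : E) p)).
  move=> l _; have [xl wl] := xw (p + l)%N; have pl : (p < (p + l).+1)%N by lia.
  rewrite /T /= normrM -[leRHS]mul1r; apply: ler_pM => //.
    by apply: xl; have := ltn_ord h; lia.
  by apply: wl => //; have := ltn_ord i; lia.
(* [v] annihilates the part of rank at most [p]. In the column [m] where [|v m|] is maximal, this
   leaves [(p + 2) |v m| <= (p + 1) |v m|]. *)
have [v v0 vA] := mulmx_tall_ker (\matrix_(h < p.+1, l < p) (x l h : R)).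
pose m := [arg max_(j > ord0) `|v 0 j|]%O.
have vm j : `|v 0 j| <= `|v 0 m|.
  by rewrite /m; case: Order.TotalTheory.arg_maxP => // i _; apply.
have vm0 : 0 < `|v 0 m|.
  rewrite normr_gt0; apply: contra_neq v0 => vm0; apply/rowP => j.
  by apply/eqP; rewrite mxE -normr_le0 (le_trans (vm j))// vm0 normr0.
have : p.+2%:R * v 0 m = \sum_h v 0 h * B h m.
  transitivity (\sum_h v 0 h * (p.+2%:R * (h == m)%:R)).
    rewrite (bigD1 m)//= eqxx mulr1 mulrC big1 ?addr0// => h /negPf ->.
    by rewrite !mulr0.
  under eq_bigr => h _ do rewrite entryE mulrDr mulr_sumr.
  rewrite big_split /= exchange_big big1 ?add0r// => l _ /=.
  under eq_bigr => h _ do rewrite mulrA.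
  rewrite -mulr_suml (_ : \sum_h _ = 0) ?mul0r//.
  have := congr1 (fun M : 'rV_p => M 0 l) vA; rewrite mxE [RHS]mxE => vAl.
  by apply: etrans vAl; apply: eq_bigr => h _; rewrite mxE.
move=> /(congr1 Num.norm); rewrite normrM normr_nat => pv.
have : p.+2%:R * `|v 0 m| <= p.+1%:R * `|v 0 m|.
  rewrite pv (le_trans (ler_norm_sum _ _ _))//.
  rewrite -[X in _ <= X%:R * _](card_ord p.+1) mulr_natl -sumr_const ler_sum// => h _.
  by rewrite normrM -[leRHS]mulr1 ler_pM.
by rewrite ler_pM2r// ler_nat ltnn.
Qed.

End NonAssociativity.

Theorem mainTheorem2 (R : realType) :
  let E : topologicalLmodType R := RN R in
  let EE : topologicalLmodType R := tensor E E in
  let EE_E : topologicalLmodType R := tensor EE E in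
  let E_EE : topologicalLmodType R := tensor E EE in
  (forall A : topologicalLmodType R -> Prop,
     A = @hausdorff_tvs R \/ A = @complete_hausdorff_tvs R ->
     [/\ @is_tvs_tensor R A E E EE (@tens R E E),
         @is_tvs_tensor R A EE E EE_E (@tens R EE E),
         @is_tvs_tensor R A E EE E_EE (@tens R E EE),
         ~ (exists Theta : EE_E -> E_EE,
              [/\ linear Theta, continuous Theta &
                forall x y z : E,
                  Theta (tens (tens x y : EE) z) = tens x (tens y z : EE)]) &
         ~ (exists Theta : EE_E -> E_EE,
              tvs_iso Theta /\
                forall x y z : E,
                  Theta (tens (tens x y : EE) z) = tens x (tens y z : EE))]) /\
  [/\ @is_group_tensor hausdorff_group E E EE (@tens R E E),
      @is_group_tensor hausdorff_group EE E EE_E (@tens R EE E),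
      @is_group_tensor hausdorff_group E EE E_EE (@tens R E EE),
      ~ (exists Theta : EE_E -> E_EE,
           [/\ zmod_morphism Theta, continuous Theta &
             forall x y z : E,
               Theta (tens (tens x y : EE) z) = tens x (tens y z : EE)]) &
      ~ (exists Theta : EE_E -> E_EE,
           group_iso (Theta : (EE_E : topologicalZmodType) -> E_EE) /\
             forall x y z : E,
               Theta (tens (tens x y : EE) z) = tens x (tens y z : EE))].

Proof.
move=> E EE EE_E E_EE.
have hE : hausdorff_space E := @RN_hausdorff R.
have hEE : hausdorff_space EE by exact: tensor_RN_hausdorff.
have hE_EE : hausdorff_space E_EE by exact: tensor_RN_hausdorff.
have hEE_E : hausdorff_space EE_E by exact: tensor_swap_hausdorff.
have cE : complete_group E := @RN_complete R.
have cEE : complete_group EE by exact: tensor_RN_complete.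
have cE_EE : complete_group E_EE by exact: tensor_RN_complete.
have cEE_E : complete_group EE_E by exact: tensor_swap_complete.
split; last first.
  split; try exact: tensor_is_group_tensor.
    by move=> [Theta [ThB cTh ThE]]; exact: tensor_RN_not_assoc ThE.
  by move=> [Theta [[ThB cTh _] ThE]]; exact: tensor_RN_not_assoc ThE.
(* The universal property among all spaces restricts to any class containing the factors and their
   tensor product. *)
have sub (A : topologicalLmodType R -> Prop) (X Y : topologicalLmodType R) :
    A X -> A Y -> A (tensor X Y : topologicalLmodType R) ->
    is_tvs_tensor A (@tens R X Y).
  move=> AX AY AXY; have [_ [bt ct univ]] := @tensor_is_tvs_tensor R X Y.
  by split=> //; split=> // G f _; exact: univ.
have linB (f : EE_E -> E_EE) : linear f -> zmod_morphism f.
  by move=> lf x y; rewrite -scaleN1r addrC lf scaleN1r addrC.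
move=> A [->|->]; split; try exact: sub;
  by [move=> [Theta [/linB ThB cTh ThE]]; exact: tensor_RN_not_assoc ThE
     |move=> [Theta [[/linB ThB cTh _] ThE]]; exact: tensor_RN_not_assoc ThE].
Qed.
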